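(* Consider the networked closed-loop system described in the context, with matrices $A,B_1,B_2,C_1,C_2,D_1,D_2,K$, network delays $\eta_k\le\eta_M$, and sampling instants generated by the event-trigger $$s_{k+1}=\min\{s\ge s_k+h\mid (y(s)-y(s_k))^T\Omega(y(s)-y(s_k))\ge\varepsilon\, y^T(s)\Omega y(s)\}.$$ For given $\gamma>0$, $h>0$, $\eta_M\ge0$, $\varepsilon\ge0$, $\delta>0$ let there exist real $n\times n$ matrices $P>0$, $S_0\ge0$, $S_1\ge0$, $R_0\ge0$, $R_1\ge0$, $G_1$, $G_0$ and a real $l\times l$ matrix $\Omega\ge0$ (the one used in the event-trigger) such that $$\Psi\le0,\quad \Phi\le0,\quad \begin{bmatrix} R_0 & G_0 \\ G_0^T & R_0 \end{bmatrix}\ge0,\quad \begin{bmatrix} R_1 & G_1 \\ G_1^T & R_1 \end{bmatrix}\ge0,$$ where, with $\tau_M=h+\eta_M$ and $H=\eta_M^2R_0+h^2R_1$, $\Psi=\{\Psi_{ij}\}_{i,j=1}^{7}$ (block sizes $n,n,n,n,n_w,n_v,n$) and $\Phi=\{\Phi_{ij}\}_{i,j=1}^{8}$ (block sizes $n,n,n,n,l,n_w,n_v,n$) are the symmetric block matrices whose upper-triangular blocks are $$\Psi_{11}=\Phi_{11}=A^TP+PA+2\delta P+S_0-e^{-2\delta\eta_M}R_0+C_1^TC_1,$$ $$\Psi_{12}=e^{-2\delta\eta_M}R_0,\qquad \Psi_{14}=PB_2KC_2+C_1^TD_1KC_2,$$ $$\Psi_{15}=\Phi_{16}=PB_1,\qquad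 \Psi_{16}=\Phi_{17}=PB_2KD_2+C_1^TD_1KD_2,\qquad \Psi_{17}=\Phi_{18}=A^TH,$$ $$\Psi_{22}=\Phi_{22}=e^{-2\delta\eta_M}(S_1-S_0-R_0)-e^{-2\delta\tau_M}R_1,$$ $$\Psi_{23}=e^{-2\delta\tau_M}G_1,\qquad \Psi_{24}=e^{-2\delta\tau_M}(R_1-G_1),$$ $$\Psi_{33}=\Phi_{33}=-e^{-2\delta\tau_M}(R_1+S_1),\qquad \Psi_{34}=e^{-2\delta\tau_M}(R_1-G_1^T),$$ $$\Psi_{44}=e^{-2\delta\tau_M}(G_1+G_1^T-2R_1)+(D_1KC_2)^TD_1KC_2,\qquad \Psi_{46}=(D_1KC_2)^TD_1KD_2,$$ $$\Psi_{47}=\Phi_{48}=(B_2KC_2)^TH,\qquad \Psi_{55}=\Phi_{66}=-\gamma^2I,\qquad \Psi_{57}=\Phi_{68}=B_1^TH,\qquad \Psi_{77}=\Phi_{88}=-H,$$ $$\Psi_{66}=(D_1KD_2)^TD_1KD_2-\gamma^2I,\qquad \Psi_{67}=\Phi_{78}=(B_2KD_2)^TH,$$ $$\Phi_{12}=e^{-2\delta\eta_M}G_0,\qquad \Phi_{14}=PB_2KC_2+e^{-2\delta\eta_M}(R_0-G_0)+C_1^TD_1KC_2,$$ $$\Phi_{23}=e^{-2\delta\tau_M}R_1,\qquad \Phi_{24}=e^{-2\delta\eta_M}(R_0-G_0^T),\qquad \Phi_{15}=PB_2K+C_1^TD_1K,$$ $$\Phi_{44}=e^{-2\delta\eta_M}(G_0+G_0^T-2R_0)+(D_1KC_2)^TD_1KC_2+\varepsilon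 C_2^T\Omega C_2,$$ $$\Phi_{45}=(D_1KC_2)^TD_1K,\qquad \Phi_{47}=(D_1KC_2)^TD_1KD_2+\varepsilon C_2^T\Omega D_2,$$ $$\Phi_{55}=(D_1K)^TD_1K-\Omega,\qquad \Phi_{57}=(D_1K)^TD_1KD_2,\qquad \Phi_{58}=(B_2K)^TH,$$ $$\Phi_{77}=(D_1KD_2)^TD_1KD_2+\varepsilon D_2^T\Omega D_2-\gamma^2I,$$ all other upper-triangular blocks being zero. Then the closed-loop system under this event-trigger is internally exponentially stable with decay rate $\delta$ and has $L_2$-gain less than $\gamma$.
   Context: For symmetric matrices, $M>0$, $M\ge0$, $M\le0$ mean positive definite, positive semidefinite, negative semidefinite; matrices written $P>0$, $S_i\ge0$, $R_i\ge 0$, $\Omega\ge0$ are symmetric. System. The plant is $$\dot x(t)=Ax(t)+B_1w(t)+B_2u(t),\quad z(t)=C_1x(t)+D_1u(t),\quad y(t)=C_2x(t)+D_2v(t),$$ with state $x\in\mathbb{R}^n$, input $u\in\mathbb{R}^m$, controlled output $z\in\mathbb{R}^{n_z}$, measurement $y\in\mathbb{R}^l$, disturbances $w\in\mathbb{R}^{n_w}$, $v\in\mathbb{R}^{n_v}$; all matrices are real constant matrices of compatible sizes, and $K\in\mathbb{R}^{m\times l}$ is a given gain. The sampling instants form a sequence $0=s_0<s_1<s_2<\dots$ with $\lim_{k\to\infty} s_k=\infty$. The transmitted measurement $y(s_k)$ is subject to an overall network-induced delay $\eta_k$ with $0\le\eta_k\le\eta_M$; the delays are such that the updating times $t_k=s_k+\eta_k$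 satisfy $t_k\le t_{k+1}$ for all $k\ge 0$. The control is $u(t)=Ky(s_k)$ for $t\in[t_k,t_{k+1})$, so that the closed-loop system is, for $t\in[t_k,t_{k+1})$, $k\ge0$, $$\dot x(t)=Ax(t)+B_1w(t)+B_2K[C_2x(t_k-\eta_k)+D_2v(t_k-\eta_k)],$$ $$z(t)=C_1x(t)+D_1K[C_2x(t_k-\eta_k)+D_2v(t_k-\eta_k)].$$ Function $\tau(t)$. For $t\in[t_k,\min\{t_k+h,t_{k+1}\})$ put $\tau(t)=t-s_k$. For $t\in[\min\{t_k+h,t_{k+1}\},t_{k+1})$ put $\tau(t)=\bar\eta(t)$, where $$\bar\eta(t)=\frac{t_{k+1}-t}{t_{k+1}-t_k-h}\,\eta_k+\frac{t-t_k-h}{t_{k+1}-t_k-h}\,\eta_{k+1}.$$ Internal exponential stability with decay rate $\delta$: with $w\equiv0$, $v\equiv0$ the closed-loop system is exponentially stable with decay rate $\delta$, i.e. its solutions are bounded in norm by $Me^{-\delta t}$ times the size of the initial data, with a constant $M>0$ independent of the solution. $L_2$-gain less than $\gamma$: for the zero initial condition $x(0)=0$ and all $w,v\in L_2[0,\infty)$ such that $w^T(t)w(t)+v^T(t-\tau(t))v(t-\tau(t))\not\equiv0$, the following holds along the trajectories of the closed-loop system: $$J=\int_0^\infty\Bigl\{z^T(t)z(t)-\gamma^2\bigl[w^T(t)w(t)+v^T(t-\tau(t))v(t-\tau(t))\bigr]\Bigr\}\,dt<0.$$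
   Formalization: With the literal τ the L2-gain claim fails; here, if s_{k+1}=s_k+h, τ(t)=t−s_k on all of [t_k,t_{k+1}) (a change only if η_{k+1}>η_k). Before t_0, u=0 and v(t−τ(t)) counts as 0; J is the lim sup of integrals over [0,T]. *)

(* Defs.v *)
(* MathComp-Analysis *)
From HB Require Import structures.
From mathcomp Require Import all_boot all_order all_algebra.
From mathcomp Require Import all_classical all_reals all_analysis.

Set Implicit Arguments.
Unset Strict Implicit.
Unset Printing Implicit Defensive.

Import Order.TTheory GRing.Theory Num.Theory.
Import numFieldNormedType.Exports.

Local Open Scope classical_set_scope.
Local Open Scope ring_scope.

Section QuadraticForms.
Variable R : realType.

Definition qform p (M : 'M[R]_p) (x : 'cV[R]_p) : R := (x^T *m M *m x) 0 0.

Definition sqnorm p (x : 'cV[R]_p) : R := (x^T *m x) 0 0.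
Definition enorm p (x : 'cV[R]_p) : R := Num.sqrt (sqnorm x).

Definition posdef p (M : 'M[R]_p) : Prop :=
  M^T = M /\ forall x : 'cV[R]_p, x != 0 -> 0 < qform M x.
Definition possemidef p (M : 'M[R]_p) : Prop :=
  M^T = M /\ forall x : 'cV[R]_p, 0 <= qform M x.
Definition negsemidef p (M : 'M[R]_p) : Prop :=
  M^T = M /\ forall x : 'cV[R]_p, qform M x <= 0.

(* Symmetric completion: iterated on the lower right corner, it builds a
   symmetric block matrix from its upper-triangular blocks. *)
Definition symblock p q (A : 'M[R]_p) (B : 'M[R]_(p, q)) (C : 'M[R]_q)
    : 'M[R]_(p + q) := block_mx A B B^T C.

End QuadraticForms.

Record ncs (R : realType) (n m nz l nw nv : nat) := Ncs {
  mA : 'M[R]_n;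
  mB1 : 'M[R]_(n, nw);
  mB2 : 'M[R]_(n, m);
  mC1 : 'M[R]_(nz, n);
  mC2 : 'M[R]_(l, n);
  mD1 : 'M[R]_(nz, m);
  mD2 : 'M[R]_(l, nv);
  gainK : 'M[R]_(m, l)
}.

Section LMI.
Variables (R : realType) (n m nz l nw nv : nat) (S : ncs R n m nz l nw nv).
Variables (gamma h etaM eps delta : R).
Variables (P S0 S1 R0 R1 G0 G1 : 'M[R]_n) (Omega : 'M[R]_l).

Let A := mA S.
Let B1 := mB1 S.
Let C1 := mC1 S.
Let C2 := mC2 S.
Let D2 := mD2 S.
Let B2K := mB2 S *m gainK S.
Let B2KC2 := B2K *m C2.
Let B2KD2 := B2K *m D2.
Let D1K := mD1 S *m gainK S.
Let D1KC2 := D1K *m C2.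
Let D1KD2 := D1K *m D2.

Let a := expR (- (2 * delta * etaM)).
Let b := expR (- (2 * delta * (h + etaM))).
Let H := etaM ^+ 2 *: R0 + h ^+ 2 *: R1.

Let X11 := A^T *m P + P *m A + (2 * delta) *: P + S0 - a *: R0 + C1^T *m C1.
Let X22 := a *: (S1 - S0 - R0) - b *: R1.
Let X33 := - (b *: (R1 + S1)).

Definition lmiPsi : 'M[R]_(n + (n + (n + (n + (nw + (nv + n)))))) :=
  let Psi12 := a *: R0 in
  let Psi14 := P *m B2KC2 + C1^T *m D1KC2 in
  let Psi15 := P *m B1 in
  let Psi16 := P *m B2KD2 + C1^T *m D1KD2 in
  let Psi17 := A^T *m H in
  let Psi23 := b *: G1 in
  let Psi24 := b *: (R1 - G1) in
  let Psi34 := b *: (R1 - G1^T) in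
  let Psi44 := b *: (G1 + G1^T - 2 *: R1) + D1KC2^T *m D1KC2 in
  let Psi46 := D1KC2^T *m D1KD2 in
  let Psi47 := B2KC2^T *m H in
  let Psi55 := - (gamma ^+ 2)%:M in
  let Psi57 := B1^T *m H in
  let Psi66 := D1KD2^T *m D1KD2 - (gamma ^+ 2)%:M in
  let Psi67 := B2KD2^T *m H in
  let Psi77 := - H in
  symblock X11
    (row_mx Psi12 (row_mx 0 (row_mx Psi14 (row_mx Psi15 (row_mx Psi16 Psi17)))))
  (symblock X22
                 (row_mx Psi23 (row_mx Psi24 (row_mx 0 (row_mx 0 0))))
  (symblock X33
                            (row_mx Psi34 (row_mx 0 (row_mx 0 0)))
  (symblock Psi44
                                          (row_mx 0 (row_mx Psi46 Psi47))
  (symblock Psi55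
                                                    (row_mx 0 Psi57)
  (symblock Psi66
                                                              Psi67
            Psi77))))).

Definition lmiPhi : 'M[R]_(n + (n + (n + (n + (l + (nw + (nv + n))))))) :=
  let Phi12 := a *: G0 in
  let Phi14 := P *m B2KC2 + a *: (R0 - G0) + C1^T *m D1KC2 in
  let Phi15 := P *m B2K + C1^T *m D1K in
  let Phi16 := P *m B1 in
  let Phi17 := P *m B2KD2 + C1^T *m D1KD2 in
  let Phi18 := A^T *m H in
  let Phi23 := b *: R1 in
  let Phi24 := a *: (R0 - G0^T) in
  let Phi44 := a *: (G0 + G0^T - 2 *: R0) + D1KC2^T *m D1KC2
               + eps *: (C2^T *m Omega *m C2) in
  let Phi45 := D1KC2^T *m D1K in
  let Phi47 := D1KC2^T *m D1KD2 + eps *: (C2^T *m Omega *m D2) in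
  let Phi48 := B2KC2^T *m H in
  let Phi55 := D1K^T *m D1K - Omega in
  let Phi57 := D1K^T *m D1KD2 in
  let Phi58 := B2K^T *m H in
  let Phi66 := - (gamma ^+ 2)%:M in
  let Phi68 := B1^T *m H in
  let Phi77 := D1KD2^T *m D1KD2 + eps *: (D2^T *m Omega *m D2)
               - (gamma ^+ 2)%:M in
  let Phi78 := B2KD2^T *m H in
  let Phi88 := - H in
  symblock X11
    (row_mx Phi12 (row_mx 0 (row_mx Phi14 (row_mx Phi15
                                    (row_mx Phi16 (row_mx Phi17 Phi18))))))
  (symblock X22
                 (row_mx Phi23 (row_mx Phi24 (row_mx 0
                                    (row_mx 0 (row_mx 0 0)))))
  (symblock X33
                            (row_mx 0 (row_mx 0
                                    (row_mx 0 (row_mx 0 0))))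
  (symblock Phi44
                                          (row_mx Phi45
                                    (row_mx 0 (row_mx Phi47 Phi48)))
  (symblock Phi55
                                    (row_mx 0 (row_mx Phi57 Phi58))
  (symblock Phi66
                                              (row_mx 0 Phi68)
  (symblock Phi77
                                                        Phi78
            Phi88)))))).

End LMI.

Section ClosedLoop.
Variables (R : realType) (n m nz l nw nv : nat) (S : ncs R n m nz l nw nv).
Variables (h etaM eps : R) (Omega : 'M[R]_l).

Notation mu := (@lebesgue_measure R).

Definition sampling_instants (s : nat -> R) : Prop :=
  [/\ s 0%N = 0, forall k, s k < s k.+1 & s @ \oo --> +oo].

Definition updating_time (s eta : nat -> R) (k : nat) : R := s k + eta k.

Definition network_delays (s eta : nat -> R) : Prop :=
  (forall k, 0 <= eta k <= etaM) /\
  (forall k, updating_time s eta k <= updating_time s eta k.+1).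

Definition measurement (x : R -> 'cV[R]_n) (v : R -> 'cV[R]_nv) (t : R)
    : 'cV[R]_l := mC2 S *m x t + mD2 S *m v t.

Definition trigger_set (y : R -> 'cV[R]_l) (sk : R) : set R :=
  [set r | sk + h <= r /\ eps * qform Omega (y r) <= qform Omega (y r - y sk)].

Definition event_triggered (y : R -> 'cV[R]_l) (s : nat -> R) : Prop :=
  forall k, trigger_set y (s k) (s k.+1) /\ lbound (trigger_set y (s k)) (s k.+1).

(* Before the first update t_0 = eta_0 the actuator has received nothing. *)
Definition held_control (s eta : nat -> R) (y : R -> 'cV[R]_l)
    (u : R -> 'cV[R]_m) : Prop :=
  (forall t : R, 0 <= t < updating_time s eta 0 -> u t = 0) /\
  (forall k (t : R), updating_time s eta k <= t < updating_time s eta k.+1 ->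
     u t = gainK S *m y (s k)).

(* Disturbances are merely square integrable, so the state equation is meant
   in the sense of Caratheodory, in integrated form. *)
Definition plant_solution (w : R -> 'cV[R]_nw) (u : R -> 'cV[R]_m)
    (x : R -> 'cV[R]_n) : Prop :=
  {within `[0, +oo[, continuous x} /\
  forall (t : R) (i : 'I_n), 0 <= t ->
    x t i 0 = x 0 i 0 + \int[mu]_(r in `[0, t])
      (mA S *m x r + mB1 S *m w r + mB2 S *m u r) i 0.

Record closed_loop (w : R -> 'cV[R]_nw) (v : R -> 'cV[R]_nv)
    (s eta : nat -> R) (x : R -> 'cV[R]_n) (u : R -> 'cV[R]_m) : Prop := {
  cl_sampling : sampling_instants s;
  cl_delays : network_delays s eta;
  cl_trigger : event_triggered (measurement x v) s;
  cl_control : held_control s eta (measurement x v) u;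
  cl_plant : plant_solution w u x
}.

Definition eta_bar (s eta : nat -> R) (k : nat) (t : R) : R :=
  let tk := updating_time s eta k in
  let tk1 := updating_time s eta k.+1 in
  (tk1 - t) / (tk1 - tk - h) * eta k + (t - tk - h) / (tk1 - tk - h) * eta k.+1.

(* The second phase stands for the event-monitored times: it is mapped by
   t |-> t - eta_bar t onto [s_k + h, s_(k+1)), on which the trigger has not
   fired.  If s_(k+1) = s_k + h this interval is empty, eta_bar would give
   t - tau t = s_(k+1), where the trigger has already fired, and no bound on
   y(s_k) - y(t - tau t) is available; the whole of [t_k, t_(k+1)) then belongs
   to the first phase.  This only matters when moreover eta_k < eta_(k+1). *)
Definition is_tau (s eta : nat -> R) (tau : R -> R) : Prop :=
  forall k (t : R), updating_time s eta k <= t < updating_time s eta k.+1 ->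
    tau t = if (s k.+1 == s k + h) || (t < updating_time s eta k + h)
            then t - s k else eta_bar s eta k t.

(* v(t - tau t), with no measurement noise acting before the first update. *)
Definition delayed_noise (s eta : nat -> R) (tau : R -> R)
    (v : R -> 'cV[R]_nv) (t : R) : 'cV[R]_nv :=
  if t < updating_time s eta 0 then 0 else v (t - tau t).

Definition L2_signal p (w : R -> 'cV[R]_p) : Prop :=
  (forall i : 'I_p,
     measurable_fun (`[0, +oo[ : set R) (fun t : R => w t i 0 : R)) /\
  (\int[mu]_(t in `[0%R, +oo[) (sqnorm (w t))%:E < +oo)%E.

Definition int_exp_stable (delta : R) : Prop :=
  exists2 M : R, 0 < M &
    forall (s eta : nat -> R) (x : R -> 'cV[R]_n) (u : R -> 'cV[R]_m),
      closed_loop (fun=> 0) (fun=> 0) s eta x u ->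
      forall t : R, 0 <= t -> enorm (x t) <= M * expR (- (delta * t)) * enorm (x 0).

(* Integral over [0, +oo) as an improper integral.  For v in L2 the function
   v(t - tau t) need not be square integrable (it contains sampled values of
   v), so the integrand of J below is only locally integrable; the upper limit
   is the integral over [0, +oo) as soon as the latter is defined. *)
Definition upper_improper_integral (f : R -> R) : \bar R :=
  limf_esup (fun T : R => \int[mu]_(t in `[0%R, T]) (f t)%:E)%E (+oo_R).

Definition L2_gain_lt (gamma : R) : Prop :=
  forall (w : R -> 'cV[R]_nw) (v : R -> 'cV[R]_nv) (s eta : nat -> R)
         (x : R -> 'cV[R]_n) (u : R -> 'cV[R]_m) (tau : R -> R),
    L2_signal w -> L2_signal v ->
    closed_loop w v s eta x u -> is_tau s eta tau -> x 0 = 0 ->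
    let z t := mC1 S *m x t + mD1 S *m u t in
    let d t := sqnorm (w t) + sqnorm (delayed_noise s eta tau v t) in
    ~ {ae mu, forall t : R, 0 <= t -> d t = 0} ->
    (upper_improper_integral (fun t => (sqnorm (z t) - gamma ^+ 2 * d t)%R)
       < 0)%E.

End ClosedLoop.

(* Main.v *)
(* The state is extended by x(0) and its derivative f by 0 to t < 0, and the
   Lyapunov-Krasovskii functional is built from primitives (indefinite Lebesgue
   integrals) so that every derivative that appears is an integrand.  Along the loop,
   with xi = (x(t), x(t - eta_M), x(t - tau_M), x(t - tau), [e,] w, v, f), Jensen's
   inequality and the reciprocally convex combination inequality bound
   V' + 2 delta V + |z|^2 - gamma^2 (|w|^2 + |v|^2) by the form of Psi when
   tau >= eta_M and by that of Phi (minus the nonpositive trigger term) when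
   tau <= eta_M; choosing f itself as last entry of xi makes the H-blocks yield
   f^T H f, so no Schur complement is needed.
   Exponential stability: V decays after the first update t_0, and x' = A x on
   [0, t_0] with t_0 <= eta_M gives a uniform bound before.  L2-gain: J is at most
   -V - 2 delta int V, which is negative unless x = 0 identically; in that case
   the integrand of J is itself nonpositive and vanishes only where w = v = 0.
   Before t_0 the loop behaves, for x(0) = 0, as if tau = eta_M, v = 0 and e = 0. *)
Require Import Defs.
From HB Require Import structures.
From mathcomp Require Import all_boot all_order all_algebra.
From mathcomp Require Import all_classical all_reals all_analysis.
From mathcomp Require Import measurable_realfun ring lra.

Import Order.TTheory GRing.Theory Num.Theory.
Import numFieldNormedType.Exports.
Local Open Scope classical_set_scope.
Local Open Scope ring_scope.

Set Implicit Arguments.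
Unset Strict Implicit.
Unset Printing Implicit Defensive.

(** * Calculus of indefinite Lebesgue integrals on the real line *)

Section Primitives.
Context {R : realType}.
Notation mu := (@lebesgue_measure R).
Implicit Types (f g F G : R -> R) (a b c t : R).

Let mI a b : measurable (`[a, b] : set (measurableTypeR R)).
Proof. exact: measurable_itv. Qed.

Definition locint f := forall a b, mu.-integrable `[a, b] (EFin \o f).

(** Measurability is asked separately, because integrability of the square does not give it for [f]
    itself. *)
Definition L2loc f := measurable_fun [set: R] f /\ locint (fun t => f t ^+ 2).

(** Local absolute continuity, encoded by the integral identity: the right-hand side of the state
    equation is only locally integrable, so no pointwise derivative is available. *)
Definition primitive F f := locint f /\
  forall a b, a <= b -> F b - F a = \int[mu]_(x in `[a, b]) f x.

Lemma eq_locint f g : f =1 g -> locint f -> locint g.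
Proof. by move=> /funext ->. Qed.

Lemma locintD f g : locint f -> locint g -> locint (fun t => f t + g t).
Proof. by move=> fi gi a b; exact: (integrableD (mI a b) (fi a b) (gi a b)). Qed.

Lemma locintZ k f : locint f -> locint (fun t => k * f t).
Proof. by move=> fi a b; exact: (integrableZl (mI a b) k (fi a b)). Qed.

Lemma locint_norm f : locint f -> locint (fun t => `|f t|).
Proof. by move=> fi a b; exact: integrable_norm. Qed.

Lemma locint_continuous f : continuous f -> locint f.
Proof.
move=> cf a b; apply: continuous_compact_integrable; first exact: segment_compact.
exact: continuous_subspaceT.
Qed.

Lemma continuous_segment_bounded f a b :
  continuous f -> exists2 k, 0 <= k & forall t, a <= t <= b -> `|f t| <= k.
Proof.
move=> cf.
have [ab|ba] := leP a b; last first.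
  by exists 0 => // t /andP[h1 h2]; have := le_trans h1 h2; rewrite leNgt ba.
have cf' : {within `[a, b], continuous (fun t => `|f t|)}.
  apply: continuous_subspaceT => x; apply: continuous_comp; first exact: cf.
  exact: norm_continuous.
have [c _ hc] := EVT_max ab cf'.
by exists `|f c| => // t ht; apply: hc; rewrite in_itv.
Qed.

Lemma locintM_continuous f g : continuous f -> locint g -> locint (fun t => f t * g t).
Proof.
move=> cf gi a b.
apply: (@integrableMr _ _ _ _ _ (mI a b) f (EFin \o g)) => //.
  by apply: measurable_funTS; exact: continuous_measurable_fun.
have [k k0 hk] := @continuous_segment_bounded f a b cf.
exists k; split; first exact: num_real.
move=> M kM t /=; rewrite in_itv/= => ht.
by apply: (le_trans (hk t ht)); exact: ltW.
Qed.

Lemma locint_dominated f g : measurable_fun [set: R] f -> locint g ->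
  (forall t, `|f t| <= g t) -> locint f.
Proof.
move=> mf gi fg a b; apply: (@le_integrable _ _ _ mu _ (mI a b) _ (EFin \o g)) => //.
  by apply/measurable_EFinP; exact: measurable_funTS.
by move=> t _ /=; rewrite lee_fin (le_trans (fg t))// ler_norm.
Qed.

Lemma L2locM f g : L2loc f -> L2loc g -> locint (fun t => f t * g t).
Proof.
move=> [mf fi] [mg gi].
apply: (@locint_dominated _ (fun t => f t ^+ 2 + g t ^+ 2)).
- exact: measurable_funM.
- exact: locintD.
- move=> t; rewrite ler_norml; apply/andP; split; nra.
Qed.

Lemma L2locD f g : L2loc f -> L2loc g -> L2loc (fun t => f t + g t).
Proof.
move=> Hf Hg; have [mf fi] := Hf; have [mg gi] := Hg; split; first exact: measurable_funD.
have H := locintD (locintD fi gi) (locintZ 2 (L2locM Hf Hg)).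
by apply: eq_locint H => t; ring.
Qed.

Lemma L2locZ k f : L2loc f -> L2loc (fun t => k * f t).
Proof.
move=> [mf fi]; split; first exact: measurable_funM.
by apply: eq_locint (locintZ (k ^+ 2) fi) => t; ring.
Qed.

Lemma L2loc_continuous f : continuous f -> L2loc f.
Proof.
move=> cf; split; first exact: continuous_measurable_fun.
by apply: locint_continuous => t; apply: continuousM; exact: cf.
Qed.

Lemma L2loc_locint f : L2loc f -> locint f.
Proof.
move=> H; have H1 : L2loc (fun=> 1 : R) by apply: L2loc_continuous => t; exact: cvg_cst.
by apply: eq_locint (L2locM H H1) => t; rewrite mulr1.
Qed.

Lemma L2loc_sum (I : Type) (r : seq I) (f : I -> R -> R) :
  (forall i, L2loc (f i)) -> L2loc (fun t => \sum_(i <- r) f i t).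
Proof.
move=> H; elim: r => [|i r IH].
  have -> : (fun t => \sum_(i <- [::]) f i t) = (fun=> 0) by apply/funext => t; rewrite big_nil.
  by apply: L2loc_continuous => t; exact: cvg_cst.
have -> : (fun t => \sum_(j <- i :: r) f j t) = (fun t => f i t + \sum_(j <- r) f j t).
  by apply/funext => t; rewrite big_cons.
exact: L2locD.
Qed.

Lemma locint_sum (I : Type) (r : seq I) (f : I -> R -> R) :
  (forall i, locint (f i)) -> locint (fun t => \sum_(i <- r) f i t).
Proof.
move=> H; elim: r => [|i r IH].
  have -> : (fun t => \sum_(i <- [::]) f i t) = (fun=> 0) by apply/funext => t; rewrite big_nil.
  by apply: locint_continuous => t; exact: cvg_cst.
have -> : (fun t => \sum_(j <- i :: r) f j t) = (fun t => f i t + \sum_(j <- r) f j t).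
  by apply/funext => t; rewrite big_cons.
exact: locintD.
Qed.

Lemma Rintegral_split f a b c : locint f -> a <= b -> b <= c ->
  \int[mu]_(x in `[a, c]) f x = \int[mu]_(x in `[a, b]) f x + \int[mu]_(x in `[b, c]) f x.
Proof.
move=> fi ab bc.
have := @Rintegral_itvB R f (BLeft a) (BRight c) b (fi a c).
rewrite !bnd_simp => /(_ ab bc) H.
rewrite -[X in _ = _ + X](@Rintegral_itv_obnd_cbnd _ b (BRight c)); last first.
  apply: integrableS (fi a c) => //.
  by apply: subset_itvr; rewrite bnd_simp.
by rewrite -H addrC subrK.
Qed.

Lemma primitive_ex f : locint f -> exists F, primitive F f.
Proof.
move=> fi.
(* At most one of the two segments has positive length, so the difference is the oriented integral
   from 0 to [t]. *)
exists (fun t => \int[mu]_(x in `[0, t]) f x - \int[mu]_(x in `[t, 0]) f x); split=> // a b ab.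
have e0 u v : v <= u -> \int[mu]_(x in `[u, v]) f x = 0.
  rewrite le_eqVlt => /predU1P[->|uv]; first by rewrite set_itv1 Rintegral_set1.
  by rewrite set_itv_ge ?Rintegral_set0// bnd_simp -ltNge.
have [b0|b0] := leP b 0.
  rewrite (e0 0 b)// (e0 0 a) ?(le_trans ab)// (@Rintegral_split f a b 0)//; ring.
have [a0|a0] := leP 0 a.
  rewrite (e0 b 0) ?(ltW b0)// (e0 a 0)// (@Rintegral_split f 0 a b)//; ring.
rewrite (e0 b 0) ?(ltW b0)// (e0 0 a) ?(ltW a0)// (@Rintegral_split f a 0 b) ?ltW//; ring.
Qed.

Lemma eq_primitive F f G g : F =1 G -> f =1 g -> primitive F f -> primitive G g.
Proof. by move=> /funext -> /funext ->. Qed.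

Lemma primitiveD F f G g : primitive F f -> primitive G g ->
  primitive (fun t => F t + G t) (fun t => f t + g t).
Proof.
move=> [fi Ff] [gi Gg]; split; first exact: locintD.
by move=> a b ab; rewrite RintegralD// -Ff// -Gg//; ring.
Qed.

Lemma primitiveZ k F f : primitive F f -> primitive (fun t => k * F t) (fun t => k * f t).
Proof.
move=> [fi Ff]; split; first exact: locintZ.
by move=> a b ab; rewrite RintegralZl// -Ff//; ring.
Qed.

Lemma primitiveB F f G g : primitive F f -> primitive G g ->
  primitive (fun t => F t - G t) (fun t => f t - g t).
Proof.
move=> Hf Hg.
by apply: eq_primitive (primitiveD Hf (primitiveZ (-1) Hg)) => t; rewrite mulN1r.
Qed.

Lemma primitive_sum (I : Type) (r : seq I) (F f : I -> R -> R) :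
  (forall i, primitive (F i) (f i)) ->
  primitive (fun t => \sum_(i <- r) F i t) (fun t => \sum_(i <- r) f i t).
Proof.
move=> H; split; first by apply: locint_sum => i; have [] := H i.
elim: r => [|i r IH] a b ab.
  transitivity (\int[mu]_(x in `[a, b]) (0 : R)).
    by rewrite Rintegral_cst// mul0r !big_nil subrr.
  by apply: eq_Rintegral => t _; rewrite big_nil.
transitivity (\int[mu]_(t in `[a, b]) (f i t + \sum_(j <- r) f j t)); last first.
  by apply: eq_Rintegral => t _; rewrite big_cons.
rewrite RintegralD//; [|exact: (proj1 (H i))|by apply: locint_sum => j; have [] := H j].
by rewrite -IH// -(proj2 (H i))// !big_cons; ring.
Qed.

Lemma primitive_cst k : primitive (fun=> k) (fun=> 0).
Proof.
split; first by apply: locint_continuous => t; exact: cvg_cst.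
by move=> a b ab; rewrite Rintegral_cst// mul0r subrr.
Qed.

Lemma primitive_id : primitive id (fun=> 1).
Proof.
split; first by apply: locint_continuous => t; exact: cvg_cst.
move=> a b ab; rewrite Rintegral_cst// mul1r /= lebesgue_measure_itv/= lte_fin.
by case: ltP => // ba; apply/eqP; rewrite /= subr_eq0 eq_le ba ab.
Qed.

(** The endpoint [b] is a null set, so the comparison is asked on the half-open interval only; this
    fits the update intervals, where rates are known on [[t_k, t_(k+1))]. *)
Lemma le_primitive F f G g a b : primitive F f -> primitive G g -> a <= b ->
  (forall t, a <= t < b -> f t <= g t) -> F b - F a <= G b - G a.
Proof.
move=> [fi Ff] [gi Gg] ab fg; rewrite Ff// Gg//.
have co f1 : locint f1 -> mu.-integrable `[a, b[ (EFin \o f1).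
  move=> i1; apply: integrableS (i1 a b) => //.
  by apply: subset_itvl; rewrite bnd_simp.
rewrite -!(@Rintegral_itv_bndo_bndc _ (BLeft a))//; [|exact: co|exact: co].
by apply: le_Rintegral => //; exact: co.
Qed.

Lemma primitive_nondecreasing F f a b : primitive F f -> (forall t, 0 <= f t) ->
  a <= b -> F a <= F b.
Proof.
move=> Ff f0 ab; rewrite -subr_ge0.
have := le_primitive (primitive_cst 0) Ff ab (fun t _ => f0 t).
by rewrite subrr.
Qed.

Lemma primitive_le_bound F f k a b : primitive F f -> a <= b ->
  (forall t, a <= t < b -> f t <= k) -> F b - F a <= k * (b - a).
Proof.
move=> Ff ab fk; rewrite mulrBr.
by apply: (le_primitive Ff (primitiveZ k primitive_id)) => // t ht; rewrite mulr1 fk.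
Qed.

Lemma primitive_ge_bound F f k a b : primitive F f -> a <= b ->
  (forall t, a <= t < b -> k <= f t) -> k * (b - a) <= F b - F a.
Proof.
move=> Ff ab fk; rewrite mulrBr.
by apply: (le_primitive (primitiveZ k primitive_id) Ff) => // t ht; rewrite mulr1 fk.
Qed.

Lemma primitive_continuous F f : primitive F f -> continuous F.
Proof.
move=> [fi Ff] t.
have tt : t - 1 < t + 1 by lra.
have := @parameterized_integral_continuous R _ _ f (ltW tt) (fi _ _).
move=> /(@within_continuous_continuous _ _ _ _ _ _ t tt).
have H : t \in `]t - 1, t + 1[ by rewrite in_itv/=; apply/andP; split; lra.
move=> /(_ H) ct.
have {}ct : {for t, continuous (fun u => F (t - 1) + parameterized_integral mu (t - 1) u f)}.
  by apply: continuousD => //; exact: cvg_cst.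
rewrite /prop_for /continuous_at.
(* On a neighbourhood of [t] the function [F] is a constant plus the parameterized integral started
   at [t - 1], whose continuity is known. *)
have E u : t - 1 <= u -> F (t - 1) + parameterized_integral mu (t - 1) u f = F u.
  by move=> ?; rewrite /parameterized_integral -Ff// addrC subrK.
rewrite -(E t); last lra.
apply: cvg_trans ct; apply: near_eq_cvg.
near=> u; apply: E; near: u.
by apply: filterS (lt_nbhsr (_ : t - 1 < t)) => [x /ltW//|]; lra.
Unshelve. all: by end_near. Qed.

(* Continuous induction on the supremum of the good endpoints. *)
Lemma le_local_increments (D T : R -> R) a b : a <= b ->
  (forall t, a <= t <= b -> exists2 e : R, 0 < e & forall c d, a <= c -> c <= d -> d <= b ->
     `|c - t| < e -> `|d - t| < e -> D d - D c <= T d - T c) ->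
  D b - D a <= T b - T a.
Proof.
move=> ab loc.
pose E := [set t | a <= t <= b /\ D t - D a <= T t - T a].
have Ea : E a by split; [rewrite lexx|rewrite !subrr].
have Es : has_sup E by split; [exists a|exists b => t [/andP[]]].
set s := sup E.
have as_ : a <= s by apply: ub_le_sup => //; exact: Es.2.
have sb : s <= b by apply: ge_sup; [exists a|move=> t [/andP[]]].
have [|e e0 He] := loc s; first by rewrite as_ sb.
have [c Ec cs] : exists2 c, E c & s - e < c by apply: sup_adherent.
have cs' : c <= s by apply: ub_le_sup => //; exact: Es.2.
have [/andP[ac cb] hc] := Ec.
have nc : `|c - s| < e by rewrite ltr_distl; apply/andP; split; lra.
have ext d : s <= d -> d <= b -> `|d - s| < e -> E d.
  move=> sd db nd; split; first by apply/andP; split=> //; lra.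
  by have := He c d ac (le_trans cs' sd) db nc nd; lra.
have Esup : E s by apply: ext => //; rewrite subrr normr0.
have [bs|sb'] := leP b s.
  have -> : b = s by apply/eqP; rewrite eq_le sb bs.
  by case: Esup.
have lt_sm : s < Num.min b (s + e / 2) by rewrite lt_min sb'/=; lra.
have /(ub_le_sup Es.2) : E (Num.min b (s + e / 2)).
  apply: ext => //; first exact: ltW.
    by rewrite ge_min lexx.
  rewrite ger0_norm; last by rewrite subr_ge0 ltW.
  have : Num.min b (s + e / 2) <= s + e / 2 by rewrite ge_min lexx orbT.
  by lra.
by rewrite -/s leNgt lt_sm.
Qed.

Lemma continuous_near f t e : {for t, continuous f} -> 0 < e ->
  exists2 d : R, 0 < d & forall u, `|u - t| < d -> `|f u - f t| < e.
Proof.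
move=> /cvgrPdist_lt /(_ e) /[apply] /nbhs_ballP[d /= d0 H].
by exists d => // u ut; rewrite distrC; apply: H; rewrite /ball/= distrC.
Qed.

Lemma le0_eps (x k : R) : (forall e, 0 < e -> x <= e * k) -> x <= 0.
Proof.
move=> H; rewrite leNgt; apply/negP => x0.
have k0 : 0 < k by have := H 1 ltr01; lra.
have : x <= x / (k * 2) * k by apply: H; rewrite divr_gt0// mulr_gt0.
have -> : x / (k * 2) * k = x / 2 by field; rewrite gt_eqF.
by lra.
Qed.

(* On a short interval [c, d] the increment of F G is exactly that of
   G(d) F + F(c) G, whose derivative is close to f G + F g. *)
Lemma primitiveM F f G g : primitive F f -> primitive G g ->
  primitive (fun t => F t * G t) (fun t => f t * G t + F t * g t).
Proof.
move=> Ff0 Gg.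
have gi := (proj1 Gg); have cG := primitive_continuous Gg.
have li F1 f1 : primitive F1 f1 -> locint (fun t => f1 t * G t + F1 t * g t).
  move=> Ff; apply: locintD.
    by apply: eq_locint (locintM_continuous cG (proj1 Ff)) => t; rewrite mulrC.
  by apply: locintM_continuous => //; exact: primitive_continuous Ff.
have [H Hh] := primitive_ex (li _ _ Ff0).
have half F1 f1 H1 a b : primitive F1 f1 ->
    primitive H1 (fun t => f1 t * G t + F1 t * g t) -> a <= b ->
    F1 b * G b - F1 a * G a <= H1 b - H1 a.
  move=> Ff Hh1 ab; have cF := primitive_continuous Ff.
  (* Freezing [G] at [d] and [F1] at [c] costs at most [e * (|f1| + |g|)] in the integrand; [T]
     integrates this error, and [e] is then sent to 0. *)
  have [T Tt] := primitive_ex (locintD (locint_norm (proj1 Ff)) (locint_norm gi)).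
  rewrite -subr_le0; apply: (@le0_eps _ (T b - T a)) => e e0.
  suff : F1 b * G b - F1 a * G a <= (H1 b + e * T b) - (H1 a + e * T a) by lra.
  apply: (@le_local_increments (fun t => F1 t * G t) (fun t => H1 t + e * T t)) => // t _.
  have e2 : 0 < e / 2 by lra.
  have [d1 d10 h1] := continuous_near (cF t) e2.
  have [d2 d20 h2] := continuous_near (cG t) e2.
  exists (Num.min d1 d2); first by rewrite lt_min d10.
  move=> c d _ cd _; rewrite !lt_min => /andP[c1 c2] /andP[dd1 dd2].
  have E : F1 d * G d - F1 c * G c = (G d * F1 d + F1 c * G d) - (G d * F1 c + F1 c * G c).
    by ring.
  rewrite E; apply: (le_primitive (primitiveD (primitiveZ (G d) Ff) (primitiveZ (F1 c) Gg))
    (primitiveD Hh1 (primitiveZ e Tt)) cd) => s /andP[cs sd].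
  have s1 : `|s - t| < d1.
    by move: c1 dd1; rewrite !ltr_distl => /andP[? ?] /andP[? ?]; apply/andP; split; lra.
  have s2 : `|s - t| < d2.
    by move: c2 dd2; rewrite !ltr_distl => /andP[? ?] /andP[? ?]; apply/andP; split; lra.
  have hG : `|G d - G s| <= e.
    have := h2 _ s2; have := h2 _ dd2; rewrite !ltr_distl ler_distl.
    by move=> /andP[? ?] /andP[? ?]; apply/andP; split; lra.
  have hF : `|F1 c - F1 s| <= e.
    have := h1 _ s1; have := h1 _ c1; rewrite !ltr_distl ler_distl.
    by move=> /andP[? ?] /andP[? ?]; apply/andP; split; lra.
  have {}hG : (G d - G s) * f1 s <= e * `|f1 s|.
    by apply: le_trans (ler_norm _) _; rewrite normrM; apply: ler_wpM2r.
  have {}hF : (F1 c - F1 s) * g s <= e * `|g s|.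
    by apply: le_trans (ler_norm _) _; rewrite normrM; apply: ler_wpM2r.
  by lra.
split; first exact: li.
move=> a b ab; rewrite -(proj2 Hh)//; apply/eqP; rewrite eq_le (half _ _ _ _ _ Ff0 Hh ab)/=.
(* The one-sided estimate applied to [- F] and [- H] is the reverse inequality. *)
have FN := primitiveZ (-1) Ff0; have HN := primitiveZ (-1) Hh.
have := half _ _ (fun t => -1 * H t) a b FN.
have -> : (fun t => -1 * f t * G t + -1 * F t * g t) = (fun t => -1 * (f t * G t + F t * g t)).
  by apply/funext => t; ring.
by move=> /(_ HN ab); lra.
Qed.

(** Since [f] is continuous, both increments over a short interval are its length times [f (t - k)]
    up to a relative error [e]. The comparison of local increments thus does the work of a change of
    variables. *)
Lemma primitive_shift F f k : continuous f -> primitive F f ->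
  primitive (fun t => F (t - k)) (fun t => f (t - k)).
Proof.
move=> cf0 Ff0.
have cs f1 : continuous f1 -> continuous (fun t => f1 (t - k)).
  move=> cf t; apply: (@continuous_comp _ _ _ (fun t => t - k) f1); last exact: cf.
  by apply: cvgB; [exact: cvg_id|exact: cvg_cst].
have [H Hh] := primitive_ex (locint_continuous (cs _ cf0)).
have half F1 f1 H1 a b : continuous f1 -> primitive F1 f1 ->
    primitive H1 (fun t => f1 (t - k)) -> a <= b ->
    F1 (b - k) - F1 (a - k) <= H1 b - H1 a.
  move=> cf Ff Hh1 ab.
  rewrite -subr_le0; apply: (@le0_eps _ (2 * (b - a))) => e e0.
  suff : F1 (b - k) - F1 (a - k) <= (H1 b + e * 2 * b) - (H1 a + e * 2 * a) by lra.
  apply: (@le_local_increments (fun t => F1 (t - k)) (fun t => H1 t + e * 2 * t)) => // t _.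
  have [d0 d00 h0] := continuous_near (cf (t - k)) e0.
  exists d0 => // c d _ cd _ c1 d1.
  have near s : c <= s < d -> `|f1 (s - k) - f1 (t - k)| < e.
    move=> /andP[? ?]; apply: h0.
    by move: c1 d1; rewrite !ltr_distl => /andP[? ?] /andP[? ?]; apply/andP; split; lra.
  have := @primitive_le_bound F1 f1 (f1 (t - k) + e) (c - k) (d - k) Ff.
  have := @primitive_ge_bound H1 _ (f1 (t - k) - e) c d Hh1 cd.
  rewrite lerD2r => L1 /(_ cd) L2.
  have {}L1 : (f1 (t - k) - e) * (d - c) <= H1 d - H1 c.
    by apply: L1 => s /near; rewrite ltr_distl => /andP[/ltW].
  have {}L2 : F1 (d - k) - F1 (c - k) <= (f1 (t - k) + e) * (d - k - (c - k)).
    apply: L2 => s hs; have : c <= s + k < d by move: hs => /andP[? ?]; apply/andP; split; lra.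
    by move=> /near; rewrite addrK ltr_distl => /andP[_ /ltW].
  by lra.
split; first exact: (proj1 Hh).
move=> a b ab; rewrite -(proj2 Hh)//; apply/eqP; rewrite eq_le (half _ _ _ _ _ cf0 Ff0 Hh ab)/=.
have cN : continuous (fun t => -1 * f t) by move=> t; apply: cvgMr; exact: cf0.
have := half _ _ _ _ _ cN (primitiveZ (-1) Ff0) (primitiveZ (-1) Hh) ab.
by lra.
Qed.

Lemma continuous_expRM k : continuous (fun t : R => expR (k * t)).
Proof.
move=> t; apply: (@continuous_comp _ _ _ (fun t => k * t) expR).
  by apply: cvgMr; exact: cvg_id.
exact: continuous_expR.
Qed.

Lemma primitive_expRM k : primitive (fun t => expR (k * t)) (fun t => k * expR (k * t)).
Proof.
have cd : continuous (fun t : R => k * expR (k * t)).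
  by move=> t; apply: cvgMr; exact: continuous_expRM.
split; first exact: locint_continuous.
have dE t : is_derive t 1 (fun t => expR (k * t)) (k * expR (k * t)).
  by apply: is_derive_eq; rewrite /GRing.scale/=; ring.
move=> a b; rewrite le_eqVlt => /predU1P[->|ab].
  by rewrite set_itv1 Rintegral_set1 subrr.
rewrite /Rintegral (@continuous_FTC2 _ _ (fun t => expR (k * t)))//.
- exact: continuous_subspaceT.
- split.
  + by move=> x _; have [] := dE x.
  + by apply: cvg_at_right_filter; exact: continuous_expRM.
  + by apply: cvg_at_left_filter; exact: continuous_expRM.
- by move=> x _; rewrite derive1E; have [] := dE x.
Qed.

End Primitives.

(** * Inner products and quadratic forms of block matrices *)

Section Dot.
Context {R : realType}.

Definition dotv p (x y : 'cV[R]_p) : R := (x^T *m y) 0 0.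

Lemma dotvE p (x y : 'cV[R]_p) : dotv x y = \sum_i x i 0 * y i 0.
Proof. by rewrite /dotv mxE; apply: eq_bigr => i _; rewrite mxE. Qed.

Lemma dotvC p (x y : 'cV[R]_p) : dotv x y = dotv y x.
Proof. by rewrite !dotvE; apply: eq_bigr => i _; rewrite mulrC. Qed.

Lemma dotvDr p (x y z : 'cV[R]_p) : dotv x (y + z) = dotv x y + dotv x z.
Proof. by rewrite /dotv mulmxDr mxE. Qed.

Lemma dotvZr p k (x y : 'cV[R]_p) : dotv x (k *: y) = k * dotv x y.
Proof. by rewrite /dotv -scalemxAr mxE. Qed.

Lemma dotvNr p (x y : 'cV[R]_p) : dotv x (- y) = - dotv x y.
Proof. by rewrite /dotv mulmxN mxE. Qed.

Lemma dotv0r p (x : 'cV[R]_p) : dotv x 0 = 0.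
Proof. by rewrite /dotv mulmx0 mxE. Qed.

Lemma dotvDl p (x y z : 'cV[R]_p) : dotv (x + y) z = dotv x z + dotv y z.
Proof. by rewrite dotvC dotvDr ![dotv z _]dotvC. Qed.

Lemma dotvZl p k (x y : 'cV[R]_p) : dotv (k *: x) y = k * dotv x y.
Proof. by rewrite dotvC dotvZr dotvC. Qed.

Lemma dotvNl p (x y : 'cV[R]_p) : dotv (- x) y = - dotv x y.
Proof. by rewrite dotvC dotvNr dotvC. Qed.

Lemma dotv0l p (x : 'cV[R]_p) : dotv 0 x = 0.
Proof. by rewrite dotvC dotv0r. Qed.

Lemma dotv_tr p q (M : 'M[R]_(p, q)) x y : dotv x (M^T *m y) = dotv (M *m x) y.
Proof. by rewrite /dotv trmx_mul mulmxA. Qed.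

Lemma dotv_sym p (M : 'M[R]_p) x y : M^T = M -> dotv x (M *m y) = dotv y (M *m x).
Proof. by move=> sM; rewrite -{1}sM dotv_tr dotvC. Qed.

Lemma qformE p (M : 'M[R]_p) x : qform M x = dotv x (M *m x).
Proof. by rewrite /qform /dotv mulmxA. Qed.

Lemma sqnormE p (x : 'cV[R]_p) : sqnorm x = dotv x x.
Proof. by []. Qed.

Lemma sqnorm_ge0 p (x : 'cV[R]_p) : 0 <= sqnorm x.
Proof. by rewrite sqnormE dotvE sumr_ge0// => i _; rewrite -expr2 sqr_ge0. Qed.

Lemma sqr_le_sqnorm p (x : 'cV[R]_p) i : x i 0 ^+ 2 <= sqnorm x.
Proof.
rewrite sqnormE dotvE (bigD1 i)//= -expr2 lerDl sumr_ge0// => j _.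
by rewrite -expr2 sqr_ge0.
Qed.

Lemma dotv_col p q (x y : 'cV[R]_p) (x' y' : 'cV[R]_q) :
  dotv (col_mx x x') (col_mx y y') = dotv x y + dotv x' y'.
Proof. by rewrite /dotv tr_col_mx mul_row_col mxE. Qed.

Lemma qform_symblock p q (A : 'M[R]_p) (B : 'M[R]_(p, q)) (C : 'M[R]_q) x y :
  qform (symblock A B C) (col_mx x y) =
  qform A x + 2 * dotv x (B *m y) + qform C y.
Proof.
rewrite !qformE /symblock mul_block_col dotv_col !dotvDr dotv_tr.
by rewrite [dotv (B *m y) x]dotvC; ring.
Qed.

Lemma qformN p (M : 'M[R]_p) x : qform M (- x) = qform M x.
Proof. by rewrite !qformE mulmxN dotvNr dotvNl opprK. Qed.

Lemma qformZ p (M : 'M[R]_p) k x : qform M (k *: x) = k ^+ 2 * qform M x.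
Proof. by rewrite !qformE -scalemxAr dotvZr dotvZl mulrA expr2. Qed.

End Dot.

(** * The two matrix inequalities as explicit quadratic forms *)

Section LMI_forms.
Context {R : realType} {n m nz l nw nv : nat} (S : ncs R n m nz l nw nv).
Variables (gamma h etaM eps delta : R).
Variables (P S0 S1 R0 R1 G0 G1 : 'M[R]_n) (Omega : 'M[R]_l).
Hypotheses (sP : P^T = P) (sR0 : R0^T = R0) (sR1 : R1^T = R1) (sO : Omega^T = Omega).

Let BK := mB2 S *m gainK S.
Let DK := mD1 S *m gainK S.
Let a := expR (- (2 * delta * etaM)).
Let b := expR (- (2 * delta * (h + etaM))).
Let H := etaM ^+ 2 *: R0 + h ^+ 2 *: R1.

Let push p q r (A : 'M[R]_(p, q)) (B : 'M[R]_(q, r)) (x : 'cV[R]_r) :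
  A *m B *m x = A *m (B *m x).
Proof. by rewrite mulmxA. Qed.

Let scl p q r k (A : 'M[R]_(p, q)) (x : 'M[R]_(q, r)) : (k *: A) *m x = k *: (A *m x).
Proof. by rewrite scalemxAl. Qed.

Let linE := (@dotvDl R, @dotvDr R, @dotvNl R, @dotvNr R, @dotvZl R, @dotvZr R, @dotv0r R).

Let mulE := (@mulmxDl R, @mulNmx R, @mulmxDr R, @mulmxN R, @mul_scalar_mx R, @mul0mx R,
  push, scl).

Lemma lmiPsi_qform x1 x2 x3 x4 (w : 'cV[R]_nw) (v : 'cV[R]_nv) g
    (r := mC2 S *m x4 + mD2 S *m v)
    (f := mA S *m x1 + mB1 S *m w + BK *m r) (z := mC1 S *m x1 + DK *m r) :
  qform (lmiPsi S gamma h etaM delta P S0 S1 R0 R1 G1)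
    (col_mx x1 (col_mx x2 (col_mx x3 (col_mx x4 (col_mx w (col_mx v g)))))) =
  2 * dotv x1 (P *m f) + 2 * delta * qform P x1 + qform S0 x1
  + a * (qform S1 x2 - qform S0 x2 - qform R0 (x1 - x2))
  - b * (qform S1 x3 + qform R1 (x2 - x4) + qform R1 (x4 - x3)
         + 2 * dotv (x2 - x4) (G1 *m (x4 - x3)))
  + sqnorm z - gamma ^+ 2 * (sqnorm w + sqnorm v)
  + 2 * dotv f (H *m g) - qform H g.
Proof.
rewrite /f /z /r /lmiPsi !qform_symblock !mul_row_col !qformE !sqnormE.
rewrite -/BK -/DK -/a -/b -/H.
move: H a b BK DK => K a' b' B' D'.
rewrite !mulE !linE.
rewrite !(dotv_tr (mA S)) !(dotv_tr (mB1 S)) !(dotv_tr (mC1 S)) !(dotv_tr G1).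
rewrite !(dotv_tr (D' *m mC2 S)) !(dotv_tr (D' *m mD2 S)).
rewrite !(dotv_tr (B' *m mC2 S)) !(dotv_tr (B' *m mD2 S)) !push.
(* The remaining bilinear terms occur in both orders. Symmetry of [P], [R0], [R1] and of the inner
   product selects one of them, so that [ring] sees the same atoms on both sides. *)
rewrite (dotv_sym (mA S *m x1) x1 sP) (dotv_sym x2 x1 sR0).
rewrite (dotv_sym x4 x2 sR1) (dotv_sym x3 x4 sR1) (dotvC (G1 *m x3) x4).
rewrite (dotvC (G1 *m x4) x4).
rewrite (dotvC (D' *m (mC2 S *m x4)) (mC1 S *m x1)) (dotvC (D' *m (mD2 S *m v)) (mC1 S *m x1)).
rewrite (dotvC (D' *m (mD2 S *m v)) (D' *m (mC2 S *m x4))).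
ring.
Qed.
(** Here [r] is the output at the delayed instant, [r + e] the held measurement and [e] the trigger
    error. The two [Omega] terms are the trigger condition, adjoined as in the S-procedure. *)
Lemma lmiPhi_qform x1 x2 x3 x4 (e : 'cV[R]_l) (w : 'cV[R]_nw) (v : 'cV[R]_nv) g
    (r := mC2 S *m x4 + mD2 S *m v)
    (f := mA S *m x1 + mB1 S *m w + BK *m (r + e)) (z := mC1 S *m x1 + DK *m (r + e)) :
  qform (lmiPhi S gamma h etaM eps delta P S0 S1 R0 R1 G0 Omega)
    (col_mx x1 (col_mx x2 (col_mx x3 (col_mx x4 (col_mx e (col_mx w (col_mx v g))))))) =
  2 * dotv x1 (P *m f) + 2 * delta * qform P x1 + qform S0 x1
  + a * (qform S1 x2 - qform S0 x2 - qform R0 (x1 - x4) - qform R0 (x4 - x2)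
         - 2 * dotv (x1 - x4) (G0 *m (x4 - x2)))
  - b * (qform S1 x3 + qform R1 (x2 - x3))
  + sqnorm z - gamma ^+ 2 * (sqnorm w + sqnorm v)
  + eps * qform Omega r - qform Omega e
  + 2 * dotv f (H *m g) - qform H g.
Proof.
rewrite /f /z /r /lmiPhi !qform_symblock !mul_row_col !qformE !sqnormE.
rewrite -/BK -/DK -/a -/b -/H.
move: H a b BK DK => K a' b' B' D'.
rewrite !mulE !linE.
rewrite !(dotv_tr (mA S)) !(dotv_tr (mB1 S)) !(dotv_tr (mC1 S)) !(dotv_tr G0).
rewrite !(dotv_tr (mC2 S)) !(dotv_tr (mD2 S)) !(dotv_tr B') !(dotv_tr D').
rewrite !(dotv_tr (D' *m mC2 S)) !(dotv_tr (D' *m mD2 S)).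
rewrite !(dotv_tr (B' *m mC2 S)) !(dotv_tr (B' *m mD2 S)) !push.
rewrite (dotv_sym (mA S *m x1) x1 sP) (dotv_sym x4 x1 sR0) (dotv_sym x4 x2 sR0).
rewrite (dotv_sym x3 x2 sR1) (dotvC (G0 *m x2) x4) (dotvC (G0 *m x4) x4).
rewrite (dotv_sym (mD2 S *m v) (mC2 S *m x4) sO).
rewrite (dotvC (D' *m (mC2 S *m x4)) (mC1 S *m x1)) (dotvC (D' *m (mD2 S *m v)) (mC1 S *m x1)).
rewrite (dotvC (D' *m (mD2 S *m v)) (D' *m (mC2 S *m x4))).
rewrite (dotvC (D' *m e) (D' *m (mC2 S *m x4))) (dotvC (D' *m e) (D' *m (mD2 S *m v))).
rewrite (dotvC (D' *m e) (mC1 S *m x1)).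
ring.
Qed.

End LMI_forms.

(** * Inequalities for semidefinite and definite forms *)

Section Forms.
Context {R : realType}.

Lemma qformD p (M N : 'M[R]_p) x : qform (M + N) x = qform M x + qform N x.
Proof. by rewrite !qformE mulmxDl dotvDr. Qed.

Lemma qform_scalel p k (M : 'M[R]_p) x : qform (k *: M) x = k * qform M x.
Proof. by rewrite !qformE -scalemxAl dotvZr. Qed.

Lemma qform0 p (M : 'M[R]_p) : qform M 0 = 0.
Proof. by rewrite qformE mulmx0 dotv0r. Qed.

Lemma qform_sum p (M : 'M[R]_p) x :
  qform M x = \sum_i \sum_j M i j * (x i 0 * x j 0).
Proof.
rewrite qformE dotvE; apply: eq_bigr => i _; rewrite mxE mulr_sumr.
by apply: eq_bigr => j _; ring.
Qed.

Lemma qform_le_sqnorm p (M : 'M[R]_p) :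
  exists2 c, 0 <= c & forall x, qform M x <= c * sqnorm x.
Proof.
(* Each product [x i 0 * x j 0] is bounded in absolute value by [sqnorm x]. *)
exists (\sum_i \sum_j `|M i j|).
  by apply: sumr_ge0 => i _; apply: sumr_ge0 => j _.
move=> x; rewrite qform_sum mulr_suml; apply: ler_sum => i _.
rewrite mulr_suml; apply: ler_sum => j _.
apply: le_trans (ler_norm _) _; rewrite normrM; apply: ler_wpM2l => //.
have := sqr_le_sqnorm x i; have := sqr_le_sqnorm x j.
by move=> h1 h2; rewrite ler_norml; apply/andP; split; nra.
Qed.

(** The form at [x + k *: y] is a nonnegative polynomial in [k], of degree 2 or, when [y] is
    isotropic, affine and hence constant. *)
Lemma psd_cauchy_schwarz p (P : 'M[R]_p) x y : possemidef P ->
  dotv x (P *m y) ^+ 2 <= qform P x * qform P y.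
Proof.
move=> [sP pP].
have E k : qform P (x + k *: y) =
    qform P x + 2 * k * dotv x (P *m y) + k ^+ 2 * qform P y.
  rewrite !qformE mulmxDr -scalemxAr !dotvDl !dotvDr !dotvZl !dotvZr.
  by rewrite (dotv_sym y x sP); ring.
have := pP y; rewrite le_eqVlt => /predU1P[y0|y0].
  rewrite -y0 mulr0.
  have -> : dotv x (P *m y) = 0; last by rewrite expr0n.
  apply/eqP/negPn/negP => b0.
  (* With this [k] the affine polynomial takes the value -1. *)
  have := pP (x + (- (qform P x + 1) / (2 * dotv x (P *m y))) *: y).
  rewrite E -y0 mulr0 addr0.
  have -> : 2 * (- (qform P x + 1) / (2 * dotv x (P *m y))) * dotv x (P *m y) =
    - (qform P x + 1) by field.
  by lra.
(* This [k] minimises the quadratic polynomial. *)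
have := pP (x + (- dotv x (P *m y) / qform P y) *: y).
rewrite E.
set b := dotv x (P *m y); set c := qform P y.
have -> : qform P x + 2 * (- b / c) * b + (- b / c) ^+ 2 * c = (qform P x * c - b ^+ 2) / c.
  by field; rewrite gt_eqF.
by rewrite pmulr_lge0 ?invr_gt0// subr_ge0.
Qed.

Lemma posdef_psd p (P : 'M[R]_p) : posdef P -> possemidef P.
Proof.
move=> [sP pP]; split=> // x.
by have [->|/pP/ltW//] := eqVneq x 0; rewrite qform0.
Qed.

Lemma posdef_unitmx p (P : 'M[R]_p) : posdef P -> P \in unitmx.
Proof.
move=> [sP pP]; rewrite -row_free_unit -kermx_eq0; apply/negPn/negP.
move=> /rowV0Pn[v /sub_kermxP vP0 v0].
have /pP : v^T != 0 by apply: contraNneq v0 => /(canRL trmxK) ->; rewrite trmx0.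
by rewrite /qform trmxK vP0 mul0mx mxE ltxx.
Qed.

(* Coordinates are controlled by Cauchy-Schwarz for the form of P, since
   x_i = (P^-1 e_i)^T P x. *)
Lemma sqnorm_le_posdef p (P : 'M[R]_p) : posdef P ->
  exists2 c, 0 < c & forall x, sqnorm x <= c * qform P x.
Proof.
move=> Ppd; have Pu := posdef_unitmx Ppd; have Ppsd := posdef_psd Ppd.
pose u i : 'cV[R]_p := invmx P *m delta_mx i 0.
have s0 : 0 <= \sum_i qform P (u i) by apply: sumr_ge0 => i _; exact: Ppsd.2.
(* The summand 1 keeps the constant positive in dimension 0 as well. *)
exists (1 + \sum_i qform P (u i)); first lra.
move=> x; have xi i : x i 0 = dotv (u i) (P *m x).
  rewrite (dotv_sym (u i) x Ppsd.1) /u mulmxA mulmxV// mul1mx dotvE (bigD1 i)//=.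
  rewrite mxE !eqxx mulr1 big1 ?addr0// => j ji.
  by rewrite mxE (negbTE ji) mulr0.
rewrite mulrDl mul1r mulr_suml.
apply: (@le_trans _ _ (\sum_i qform P (u i) * qform P x)).
  rewrite sqnormE dotvE; apply: ler_sum => i _.
  by rewrite -expr2 {1}xi; exact: psd_cauchy_schwarz.
by rewrite lerDr; exact: Ppsd.2.
Qed.

(* The reciprocally convex combination inequality, free of square roots:
   test the block matrix on (b y1, - a y2). *)
Lemma reciprocally_convex p (M G : 'M[R]_p) (a b I1 I2 : R) (y1 y2 : 'cV[R]_p) :
  possemidef (symblock M G M) -> 0 <= a -> 0 <= b -> 0 <= I1 -> 0 <= I2 ->
  qform M y1 <= a * I1 -> qform M y2 <= b * I2 ->
  (a = 0 -> y1 = 0) -> (b = 0 -> y2 = 0) ->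
  qform M y1 + qform M y2 + 2 * dotv y1 (G *m y2) <= (a + b) * (I1 + I2).
Proof.
move=> [_ MG] a0 b0 I10 I20 h1 h2 y10 y20.
have := MG (col_mx (b *: y1) (- (a *: y2))).
rewrite qform_symblock qformN !qformZ mulmxN dotvNr -scalemxAr dotvZr dotvZl => H.
have := mulr_ge0 a0 I20; have := mulr_ge0 b0 I10 => m1 m2.
move: a0; rewrite le_eqVlt => /predU1P[a0|a0].
  by rewrite y10// dotv0l qform0 in h1 H *; rewrite -a0 in h1 m2 *; lra.
move: b0; rewrite le_eqVlt => /predU1P[b0|b0].
  by rewrite y20// mulmx0 dotv0r qform0 in h2 H *; rewrite -b0 in h2 m1 *; lra.
suff : 2 * dotv y1 (G *m y2) <= b * I1 + a * I2 by lra.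
(* After multiplication by [a * b], the claim is the test inequality [H] combined with [b ^+ 2] and
   [a ^+ 2] times the bounds on the two forms. *)
rewrite -(ler_pM2l (mulr_gt0 a0 b0)).
have k1 := ler_wpM2l (sqr_ge0 b) h1.
have k2 := ler_wpM2l (sqr_ge0 a) h2.
lra.
Qed.
End Forms.

(** * Jensen-type bounds and the Lyapunov-Krasovskii functional *)

Section Functional.
Context {R : realType} {n : nat}.
Variables (x f : R -> 'cV[R]_n).
Hypothesis xf : forall i, primitive (fun t => x t i 0) (fun t => f t i 0).
Hypothesis f2 : forall i, L2loc (fun t => f t i 0).

Lemma primitive_dotv c : primitive (fun t => dotv c (x t)) (fun t => dotv c (f t)).
Proof.
have := primitive_sum (index_enum 'I_n) (fun i => primitiveZ (c i 0) (xf i)).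
by apply: eq_primitive => t; rewrite dotvE.
Qed.

Lemma primitive_qform (P : 'M[R]_n) : P^T = P ->
  primitive (fun t => qform P (x t)) (fun t => 2 * dotv (x t) (P *m f t)).
Proof.
move=> sP.
have := primitive_sum (index_enum 'I_n) (fun i => primitive_sum (index_enum 'I_n)
  (fun j => primitiveZ (P i j) (primitiveM (xf i) (xf j)))).
apply: eq_primitive => t; first by rewrite qform_sum.
have -> : 2 * dotv (x t) (P *m f t) = dotv (f t) (P *m x t) + dotv (x t) (P *m f t).
  by rewrite (dotv_sym (f t) (x t) sP); ring.
rewrite !dotvE -big_split; apply: eq_bigr => i _; rewrite !mxE !mulr_sumr -big_split.
by apply: eq_bigr => j _ /=; ring.
Qed.

Lemma continuous_qform (P : 'M[R]_n) : P^T = P -> continuous (fun t => qform P (x t)).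
Proof. by move=> /primitive_qform /primitive_continuous. Qed.

Lemma locint_qform (M : 'M[R]_n) : locint (fun t => qform M (f t)).
Proof.
have := locint_sum (index_enum 'I_n) (fun i => locint_sum (index_enum 'I_n)
  (fun j => locintZ (M i j) (L2locM (f2 i) (f2 j)))).
by apply: eq_locint => t; rewrite qform_sum.
Qed.

(** The form at [f t] lies above its tangent at the mean [c] of [f], namely
    [2 * dotv (M *m c) (f t) - qform M c], and the tangent integrates exactly. The increasing
    exponential weight is replaced by its value at the left end. *)
Lemma jensen_qform (M : 'M[R]_n) k (F : R -> R) a b : possemidef M -> 0 <= k ->
  primitive F (fun t => expR (k * t) * qform M (f t)) -> a <= b ->
  expR (k * a) * qform M (x b - x a) <= (b - a) * (F b - F a).
Proof.
move=> [sM M0] k0 HF; rewrite le_eqVlt => /predU1P[->|ab].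
  by rewrite !subrr mul0r qform0 mulr0.
set y := x b - x a; pose c := (b - a)^-1 *: y.
have ba : 0 < b - a by rewrite subr_gt0.
have HG := primitiveZ (expR (k * a))
  (primitiveB (primitiveZ 2 (primitive_dotv (M *m c))) (primitiveZ (qform M c) (@primitive_id R))).
have := le_primitive HG HF (ltW ab).
have -> : expR (k * a) * (2 * dotv (M *m c) (x b) - qform M c * b) -
  expR (k * a) * (2 * dotv (M *m c) (x a) - qform M c * a) =
  expR (k * a) * qform M y / (b - a).
  have -> : dotv (M *m c) (x b) = dotv (M *m c) y + dotv (M *m c) (x a).
    by rewrite /y dotvDr dotvNr; ring.
  rewrite [dotv _ y]dotvC /c qformZ -scalemxAr dotvZr -qformE.
  by field; rewrite gt_eqF.
move=> H; rewrite [leRHS]mulrC -ler_pdivrMr//; apply: H => t /andP[at_ _].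
rewrite mulr1; apply: (@le_trans _ _ (expR (k * a) * qform M (f t))).
  rewrite ler_pM2l ?expR_gt0//.
  have := M0 (f t - c); rewrite !qformE mulmxDr mulmxN !dotvDl !dotvDr !dotvNl !dotvNr.
  by rewrite (dotv_sym c (f t) sM) (dotvC (M *m c)); lra.
by apply: ler_wpM2r => //; rewrite ler_expR ler_wpM2l.
Qed.

(** Jensen on each side of the delayed instant [m], followed by the reciprocally convex inequality
    with the lengths [d - m] and [m - c] as weights. If one length is 0, the corresponding increment
    of [x] vanishes, as that inequality requires. *)
Lemma jensen_split (M G : 'M[R]_n) k (F : R -> R) c m d : possemidef M ->
  possemidef (symblock M G M) -> 0 <= k ->
  primitive F (fun t => expR (k * t) * qform M (f t)) -> c <= m -> m <= d ->
  expR (k * c) * (qform M (x d - x m) + qform M (x m - x c)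
    + 2 * dotv (x d - x m) (G *m (x m - x c))) <= (d - c) * (F d - F c).
Proof.
move=> M0 MG k0 HF cm md; have ec := expR_gt0 (k * c).
have F0 t : 0 <= expR (k * t) * qform M (f t) by apply: mulr_ge0; [exact: expR_ge0|exact: M0.2].
have H1 := jensen_qform M0 k0 HF md.
have H2 := jensen_qform M0 k0 HF cm.
rewrite mulrC -ler_pdivlMr//.
have -> : (d - c) * (F d - F c) / expR (k * c) =
  ((d - m) + (m - c)) * ((F d - F m) / expR (k * c) + (F m - F c) / expR (k * c)).
  by field; rewrite gt_eqF.
apply: reciprocally_convex => //; rewrite ?subr_ge0//.
- by apply: divr_ge0; [rewrite subr_ge0 (primitive_nondecreasing HF)|exact: ltW].
- by apply: divr_ge0; [rewrite subr_ge0 (primitive_nondecreasing HF)|exact: ltW].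
- rewrite mulrA ler_pdivlMr// mulrC; apply: le_trans H1.
  by apply: ler_wpM2r; [exact: M0.2|rewrite ler_expR ler_wpM2l].
- by rewrite mulrA ler_pdivlMr// mulrC.
- by move=> /eqP; rewrite subr_eq0 => /eqP ->; rewrite subrr.
- by move=> /eqP; rewrite subr_eq0 => /eqP ->; rewrite subrr.
Qed.

Variables (h eta delta : R) (P S0 S1 R0 R1 G0 G1 : 'M[R]_n).
Hypotheses (sP : P^T = P) (S0p : possemidef S0) (S1p : possemidef S1).
Hypotheses (R0p : possemidef R0) (R1p : possemidef R1).
Hypotheses (G0p : possemidef (symblock R0 G0 R0)) (G1p : possemidef (symblock R1 G1 R1)).

(** The part of V' + 2 delta V that contains no integral. What it omits is the single integrals of
    the [R0] and [R1] forms that arise, with a minus sign, from differentiating the double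
    integrals. *)
Definition lk_rate (x1 x2 x3 g : 'cV[R]_n) :=
  2 * dotv x1 (P *m g) + 2 * delta * qform P x1 + qform S0 x1
  + qform (eta ^+ 2 *: R0 + h ^+ 2 *: R1) g
  + expR (- (2 * delta * eta)) * (qform S1 x2 - qform S0 x2)
  - expR (- (2 * delta * (h + eta))) * qform S1 x3.

(* The Lyapunov-Krasovskii functional, multiplied by exp(2 delta t); each double
   integral of the usual definition is a difference of second primitives. *)
Lemma lyapunov_krasovskii : 0 <= h -> 0 <= eta -> 0 <= delta -> exists W omega : R -> R,
  [/\ primitive W omega,
   forall t, expR (2 * delta * t) * qform P (x t) <= W t,
   forall x0, (forall t, t <= 0 -> x t = x0) -> (forall t, t < 0 -> f t = 0) ->
     W 0 <= qform P x0 + eta * qform S0 x0 + h * qform S1 x0 &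
   forall t, let x1 := x t in let x2 := x (t - eta) in let x3 := x (t - (h + eta)) in
   let q := lk_rate x1 x2 x3 (f t) in
   [/\ omega t <= expR (2 * delta * t) * q,
    forall r, t - eta <= r <= t -> omega t <= expR (2 * delta * t) *
      (q - expR (- (2 * delta * eta)) *
           (qform R0 (x1 - x r) + qform R0 (x r - x2) + 2 * dotv (x1 - x r) (G0 *m (x r - x2)))
         - expR (- (2 * delta * (h + eta))) * qform R1 (x2 - x3)) &
    forall r, t - (h + eta) <= r <= t - eta -> omega t <= expR (2 * delta * t) *
      (q - expR (- (2 * delta * eta)) * qform R0 (x1 - x2)
         - expR (- (2 * delta * (h + eta))) *
           (qform R1 (x2 - x r) + qform R1 (x r - x3) + 2 * dotv (x2 - x r) (G1 *m (x r - x3))))]].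
Proof.
move=> h0 eta0 delta0; set k := 2 * delta; have k0 : 0 <= k by rewrite mulr_ge0.
have cw (M : 'M[R]_n) : M^T = M -> continuous (fun t => expR (k * t) * qform M (x t)).
  move=> sM t; apply: cvgM; first exact: continuous_expRM.
  exact: continuous_qform.
have lw (M : 'M[R]_n) : locint (fun t => expR (k * t) * qform M (f t)).
  by apply: locintM_continuous; [exact: continuous_expRM|exact: locint_qform].
have [Q0 Q0p] := primitive_ex (locint_continuous (cw _ S0p.1)).
have [Q1 Q1p] := primitive_ex (locint_continuous (cw _ S1p.1)).
have [F0 F0p] := primitive_ex (lw R0).
have [F1 F1p] := primitive_ex (lw R1).
have cF0 := primitive_continuous F0p; have cF1 := primitive_continuous F1p.
have [E0 E0p] := primitive_ex (locint_continuous cF0).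
have [E1 E1p] := primitive_ex (locint_continuous cF1).
pose tM := h + eta.
have nn (M : 'M[R]_n) (g : R -> 'cV[R]_n) t : possemidef M -> 0 <= expR (k * t) * qform M (g t).
  by move=> [_ M0]; apply: mulr_ge0; [exact: expR_ge0|exact: M0].
have mF0 u v : u <= v -> F0 u <= F0 v.
  by apply: (primitive_nondecreasing F0p) => t; exact: nn.
have mF1 u v : u <= v -> F1 u <= F1 v.
  by apply: (primitive_nondecreasing F1p) => t; exact: nn.
(* The last two terms are [eta] times the integral of [F0 t - F0 s] over [[t - eta, t]] and [h]
   times that of [F1 t - F1 s] over [[t - tM, t - eta]]. Each difference integrates the weighted
   form of [f] over [[s, t]], which gives the usual double integrals. *)
pose W t := expR (k * t) * qform P (x t) + (Q0 t - Q0 (t - eta)) + (Q1 (t - eta) - Q1 (t - tM))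
  + eta * (eta * F0 t - (E0 t - E0 (t - eta))) + h * (h * F1 t - (E1 (t - eta) - E1 (t - tM))).
pose om t := (k * expR (k * t) * qform P (x t) + expR (k * t) * (2 * dotv (x t) (P *m f t)))
  + (expR (k * t) * qform S0 (x t) - expR (k * (t - eta)) * qform S0 (x (t - eta)))
  + (expR (k * (t - eta)) * qform S1 (x (t - eta)) - expR (k * (t - tM)) * qform S1 (x (t - tM)))
  + eta * (eta * (expR (k * t) * qform R0 (f t)) - (F0 t - F0 (t - eta)))
  + h * (h * (expR (k * t) * qform R1 (f t)) - (F1 (t - eta) - F1 (t - tM))).
have Wp : primitive W om.
  apply: primitiveD; last first.
    apply: primitiveZ; apply: primitiveB; first exact: primitiveZ.
    by apply: primitiveB; exact: primitive_shift.
  apply: primitiveD; last first.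
    apply: primitiveZ; apply: primitiveB; first exact: primitiveZ.
    by apply: primitiveB => //; exact: primitive_shift.
  apply: primitiveD; last first.
    by apply: primitiveB; [exact: (primitive_shift eta (cw _ S1p.1) Q1p)|exact: (primitive_shift tM (cw _ S1p.1) Q1p)].
  apply: primitiveD; last by apply: primitiveB => //; exact: (primitive_shift eta (cw _ S0p.1) Q0p).
  by apply: primitiveM; [exact: primitive_expRM|exact: primitive_qform].
have em c t : expR (k * (t - c)) = expR (k * t) * expR (- (k * c)).
  by rewrite -expRD; congr expR; ring.
have omE t : om t = expR (k * t) * lk_rate (x t) (x (t - eta)) (x (t - tM)) (f t)
    - eta * (F0 t - F0 (t - eta)) - h * (F1 (t - eta) - F1 (t - tM)).
  rewrite /om /lk_rate !em qformD !qform_scalel -/k -/tM; ring.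
exists W, om; split=> //.
- move=> t; rewrite /W.
  have : Q0 (t - eta) <= Q0 t.
    by apply: (primitive_nondecreasing Q0p) => [s|]; [exact: nn|lra].
  have : Q1 (t - tM) <= Q1 (t - eta).
    by apply: (primitive_nondecreasing Q1p) => [s|]; [exact: nn|rewrite /tM; lra].
  have : E0 t - E0 (t - eta) <= F0 t * (t - (t - eta)).
    by apply: (primitive_le_bound E0p) => [|s /andP[_ ?]]; [lra|apply: mF0; exact: ltW].
  have : E1 (t - eta) - E1 (t - tM) <= F1 t * (t - eta - (t - tM)).
    by apply: (primitive_le_bound E1p) => [|s /andP[_ ?]]; [rewrite /tM; lra|apply: mF1; lra].
  have -> : t - (t - eta) = eta by ring.
  have -> : t - eta - (t - tM) = h by rewrite /tM; ring.
  move=> B1 B2 B3 B4.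
  have : 0 <= eta * (eta * F0 t - (E0 t - E0 (t - eta))) by apply: mulr_ge0 => //; lra.
  have : 0 <= h * (h * F1 t - (E1 (t - eta) - E1 (t - tM))) by apply: mulr_ge0 => //; lra.
  by move: B3 B4; lra.
- move=> x0 Hx Hf; rewrite /W mulr0 expR0 mul1r (Hx 0 (lexx _)).
  have e1 t : t <= 0 -> expR (k * t) <= 1.
    by move=> t0; rewrite -expR0 ler_expR; apply: mulr_ge0_le0.
  have : Q0 0 - Q0 (0 - eta) <= qform S0 x0 * (0 - (0 - eta)).
    apply: (primitive_le_bound Q0p) => [|s /andP[_ /ltW s0]]; first lra.
    by rewrite (Hx s s0) ler_piMl ?e1//; exact: S0p.2.
  have : Q1 (0 - eta) - Q1 (0 - tM) <= qform S1 x0 * (0 - eta - (0 - tM)).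
    apply: (primitive_le_bound Q1p) => [|s /andP[_ s0]]; first by rewrite /tM; lra.
    have {}s0 : s <= 0 by lra.
    by rewrite (Hx s s0) ler_piMl ?e1//; exact: S1p.2.
  (* As [f] vanishes at negative times, [F0] and [F1] do not increase up to 0, so the double
     integrals contribute nothing positive to [W 0]. *)
  have cst F (M : 'M[R]_n) u : primitive F (fun t => expR (k * t) * qform M (f t)) ->
      u <= 0 -> F 0 <= F u.
    move=> Fp u0; have := @primitive_le_bound R F _ 0 u 0 Fp u0.
    rewrite mul0r subr_le0; apply=> s /andP[_ s0].
    by rewrite (Hf s s0) qform0 mulr0.
  have : F0 0 * (0 - (0 - eta)) <= E0 0 - E0 (0 - eta).
    by apply: (primitive_ge_bound E0p) => [|s /andP[_ /ltW s0]]; [lra|exact: cst F0p s0].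
  have : F1 0 * (0 - eta - (0 - tM)) <= E1 (0 - eta) - E1 (0 - tM).
    apply: (primitive_ge_bound E1p) => [|s /andP[_ s0]]; first by rewrite /tM; lra.
    by apply: cst F1p _; lra.
  have -> : 0 - (0 - eta) = eta by ring.
  have -> : 0 - eta - (0 - tM) = h by rewrite /tM; ring.
  move=> B1 B2 B3 B4.
  have : eta * (eta * F0 0 - (E0 0 - E0 (0 - eta))) <= 0 by apply: mulr_ge0_le0 => //; lra.
  have : h * (h * F1 0 - (E1 (0 - eta) - E1 (0 - tM))) <= 0 by apply: mulr_ge0_le0 => //; lra.
  by move: B3 B4; lra.
- move=> t /=; rewrite omE -/tM -/k; set q := lk_rate _ _ _ _.
  have tM1 : t - tM <= t - eta by rewrite /tM; lra.
  have te : t - eta <= t by lra.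
  have te1 : t - (t - eta) = eta by ring.
  have te2 : t - eta - (t - tM) = h by rewrite /tM; ring.
  have p1 : 0 <= eta * (F0 t - F0 (t - eta)) by rewrite mulr_ge0// subr_ge0 mF0.
  have p2 : 0 <= h * (F1 (t - eta) - F1 (t - tM)) by rewrite mulr_ge0// subr_ge0 mF1.
  have J0 := jensen_qform R0p k0 F0p te.
  have J1 := jensen_qform R1p k0 F1p tM1.
  rewrite te1 em in J0; rewrite te2 em in J1.
  split; first by move: p1 p2; lra.
  + move=> r /andP[r1 r2].
    have := jensen_split R0p G0p k0 F0p r1 r2; rewrite te1 em.
    by move: J1; lra.
  + move=> r /andP[r1 r2].
    have := jensen_split R1p G1p k0 F1p r1 r2; rewrite te2 em.
    by move: J0; lra.
Qed.

End Functional.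

(** * Extension of functions from the half-line to the whole line *)

Section HalfLine.
Context {R : realType}.
Notation mu := (@lebesgue_measure R).

Definition cutoff (g : R -> R) (t : R) : R := if 0 <= t then g t else 0.

Lemma cutoff_patch (g : R -> R) : cutoff g = g \_ `[0, +oo[%classic.
Proof.
apply/funext => t; rewrite /cutoff patchE.
have -> : (t \in `[0, +oo[%classic) = (0 <= t); last by [].
by apply/idP/idP; rewrite inE/= in_itv/= andbT.
Qed.

Lemma measurable_cutoff (g : R -> R) :
  measurable_fun (`[0, +oo[%classic : set R) g -> measurable_fun [set: R] (cutoff g).
Proof. by move=> mg; rewrite cutoff_patch; apply/(measurable_restrictT _ _).1 => //; exact: measurable_itv. Qed.

Lemma locint_cutoff (g : R -> R) : locint g -> locint (cutoff g).
Proof.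
move=> gi a b; rewrite cutoff_patch.
have -> : EFin \o (g \_ `[0, +oo[%classic) = ((EFin \o g) \_ `[0, +oo[%classic).
  by apply/funext => t; rewrite /= !patchE/=; case: ifP.
have mD : measurable (`[0, +oo[%classic : set (measurableTypeR R)) by exact: measurable_itv.
have mI : measurable (`[a, b]%classic : set (measurableTypeR R)) by exact: measurable_itv.
apply/(integrable_mkcond _ mI).
rewrite -patch_setI setIC patch_setI; apply/(integrable_mkcond _ mD).
apply: (integrableS _ _ (@subsetT _ _)) => //.
exact/(integrable_mkcond _ mI).
Qed.

Lemma L2loc_cutoff (g : R -> R) : L2loc g -> L2loc (cutoff g).
Proof.
move=> [mg gi]; split; first by apply: measurable_cutoff; exact: measurable_funTS.
apply: eq_locint (locint_cutoff gi) => t.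
by rewrite /cutoff; case: ifP => // _; rewrite expr0n.
Qed.

(** Freezing [F] at its initial value matches the extension of its derivative by 0, so a function
    with no past still has a primitive on the whole line and delayed arguments make sense. *)
Lemma primitive_cutoff (F g : R -> R) : locint g ->
  (forall t, 0 <= t -> F t = F 0 + \int[mu]_(r in `[0, t]) g r) ->
  primitive (fun t => F (Num.max t 0)) (cutoff g).
Proof.
move=> gi HF.
have neg (t : R) : t <= 0 -> Num.max t 0 = 0 by exact: max_r.
have pos (t : R) : 0 <= t -> Num.max t 0 = t by exact: max_l.
have ci := locint_cutoff gi.
have cneg a b : b <= 0 -> \int[mu]_(r in `[a, b]) cutoff g r = 0.
  move=> b0; rewrite -(@Rintegral_itv_bndo_bndc _ (BLeft a) b); last first.
    apply: integrableS (ci a b) => //.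
    by apply: subset_itvl; rewrite bnd_simp.
  transitivity (\int[mu]_(r in `[a, b[) (0 : R)); last by rewrite Rintegral_cst// mul0r.
  apply: eq_Rintegral => t; rewrite inE/= in_itv/= => /andP[_ tb].
  by rewrite /cutoff leNgt (lt_le_trans tb b0).
have cpos a b : 0 <= a -> \int[mu]_(r in `[a, b]) cutoff g r = \int[mu]_(r in `[a, b]) g r.
  move=> a0; apply: eq_Rintegral => t; rewrite inE/= in_itv/= => /andP[at_ _].
  by rewrite /cutoff (le_trans a0 at_).
split=> // a b ab.
have [b0|/ltW b0] := leP b 0.
  by rewrite cneg// !neg ?subrr// (le_trans ab).
have [a0|/ltW a0] := leP 0 a.
  rewrite cpos// (HF b)// (HF a)// (Rintegral_split gi a0 ab); ring.
rewrite (Rintegral_split ci a0 b0) cneg// cpos// (HF b)//; ring.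
Qed.

Lemma continuous_clip (V : topologicalType) (g : R -> V) :
  {within `[0, +oo[, continuous g} -> continuous (fun t : R => g (Num.max t 0)).
Proof.
move=> /subspace_continuousP cg t.
have D u : `[0, +oo[%classic (Num.max u 0 : R) by rewrite /= in_itv/= andbT le_max lexx orbT.
apply: cvg_trans (cg _ (D t)).
have cm : Num.max u 0 @[u --> t] --> Num.max t 0.
  by apply: (@continuous_max _ _ id (cst 0)); [exact: cvg_id|exact: cvg_cst].
move=> A HA; apply: (@filterS _ (nbhs t) _ _ _ _ (cm _ HA)) => u; apply; exact: D.
Qed.

End HalfLine.

(** * The partition of time by the updating instants *)

Section Steps.
Context {R : realType}.
Variables (s eta : nat -> R) (etaM : R).
Notation T := (updating_time s eta).

Lemma updating_time_mono : network_delays etaM s eta -> {homo T : i j / (i <= j)%N >-> i <= j}.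
Proof. by move=> [_ H]; apply: homo_leq => //; exact: le_trans. Qed.

Lemma updating_time_unbounded t : sampling_instants s -> network_delays etaM s eta ->
  exists N, t < T N.
Proof.
move=> [_ _ /cvgryPgt /(_ t) [N _ HN]] [He _]; exists N.
have := HN N (leqnn N); have /andP[e0 _] := He N => /= h1.
by rewrite /updating_time; lra.
Qed.

(** The index is the predecessor of the least [N] with [t < T N]; taking the least one copes with
    empty update intervals, as [T] is only nondecreasing. *)
Lemma updating_time_cover t : sampling_instants s -> network_delays etaM s eta ->
  T 0%N <= t -> exists k, T k <= t < T k.+1.
Proof.
move=> Hs He t0; have ex := updating_time_unbounded t Hs He.
case: (ex_minnP ex) => -[|k] tk min; first by move: tk; rewrite ltNge t0.
exists k; rewrite tk andbT leNgt; apply/negP => /min.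
by rewrite ltnn.
Qed.

Lemma measurable_steps (g : R -> R) : sampling_instants s -> network_delays etaM s eta ->
  (forall t, t < T 0%N -> g t = 0) ->
  (forall k, measurable_fun (`[T k, T k.+1[%classic : set R) g) ->
  measurable_fun [set: R] g.
Proof.
move=> Hs He g0 gk.
have -> : [set: R] = `]-oo, T 0%N[%classic `|` \bigcup_k `[T k, T k.+1[%classic.
  apply/seteqP; split=> // t _; have [tT|tT] := ltP t (T 0%N).
    by left; rewrite /= in_itv.
  by right; have [k tk] := updating_time_cover Hs He tT; exists k => //=; rewrite in_itv.
apply/measurable_funU; [exact: measurable_itv|by apply: bigcup_measurable|].
split; last by apply/measurable_fun_bigcup.
apply: (@eq_measurable_fun _ _ _ _ _ (cst (0 : R)) g) => //.
by move=> t; rewrite inE/= in_itv/= => /g0.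
Qed.

(** The updating times are unbounded, so a bounded interval meets finitely many steps, and there
    [g ^+ 2] is at most the sum of the corresponding [c k ^+ 2]. *)
Lemma L2loc_steps (g : R -> R) (c : nat -> R) : sampling_instants s -> network_delays etaM s eta ->
  (forall t, t < T 0%N -> g t = 0) ->
  (forall k t, T k <= t < T k.+1 -> g t = c k) -> L2loc g.
Proof.
move=> Hs He g0 gk.
have mg : measurable_fun [set: R] g.
  apply: measurable_steps => // k; apply: (@eq_measurable_fun _ _ _ _ _ (cst (c k)) g) => //.
  by move=> t; rewrite inE/= in_itv/= => /gk.
split=> // a b.
have [N bN] := updating_time_unbounded b Hs He.
have mI : measurable (`[a, b]%classic : set (measurableTypeR R)) by exact: measurable_itv.
apply: (measurable_bounded_integrable mI).
- rewrite /= lebesgue_measure_itv/=; case: ifP => _; last exact: ltry.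
  by rewrite -EFinB ltry.
- apply: measurable_funTS; exact: measurable_funX.
- exists (\sum_(k < N) c k ^+ 2); split; first exact: num_real.
  move=> M SM t /=; rewrite in_itv/= => /andP[_ tb]; apply: le_trans (ltW SM).
  have c0 (r : seq 'I_N) : 0 <= \sum_(k <- r) c k ^+ 2.
    by apply: sumr_ge0 => k _; exact: sqr_ge0.
  rewrite ger0_norm ?sqr_ge0//.
  have [tT|tT] := ltP t (T 0%N); first by rewrite g0// expr0n/=.
  have [k tk] := updating_time_cover Hs He tT; rewrite (gk k t tk).
  have kN : (k < N)%N.
    rewrite ltnNge; apply/negP => /(updating_time_mono He) NK.
    by have := le_lt_trans (le_trans NK (proj1 (andP tk))) (le_lt_trans tb bN); rewrite ltxx.
  rewrite (bigD1 (Ordinal kN))//= lerDl; apply: sumr_ge0 => j _; exact: sqr_ge0.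
Qed.

End Steps.

(** * The held measurement as a delayed output with trigger error *)

Section SampledControl.
Context {R : realType} {n m nz l nw nv : nat} (S : ncs R n m nz l nw nv).
Variables (h etaM eps : R) (Omega : 'M[R]_l).
Variables (w : R -> 'cV[R]_nw) (v : R -> 'cV[R]_nv) (s eta : nat -> R).
Variables (x : R -> 'cV[R]_n) (u : R -> 'cV[R]_m).
Notation T := (updating_time s eta).
Notation y := (measurement S x v).

(** This is t - tau(t) on the [k]-th update interval, written without [tau] because exponential
    stability is stated with no such function at hand. *)
Definition hold_time (k : nat) (t : R) : R :=
  if (s k.+1 == s k + h) || (t < T k + h) then s k else t - eta_bar h s eta k t.

Lemma is_tau_hold_time (tau : R -> R) k t : is_tau h s eta tau ->
  T k <= t < T k.+1 -> t - tau t = hold_time k t.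
Proof.
move=> Htau tk; rewrite (Htau k t tk) /hold_time.
by case: ifP => // _; rewrite subKr.
Qed.

Lemma hold_time_sampling_ge0 k : sampling_instants s -> 0 <= s k.
Proof.
move=> [s0 s1 _]; rewrite -s0.
have sm : {homo s : i j / (i <= j)%N >-> i <= j}.
  by apply: homo_leq => [//|? ? ?|i]; [exact: le_trans|exact: ltW].
exact: sm.
Qed.

(** If [t] is the convex combination of t_k + h and t_(k+1) with weights [p], [q], then
    [t - eta_bar] is the same combination of s_k + h and s_(k+1). Strictness on the right comes from
    [q < 1]. *)
Lemma second_phase k t : 0 < h -> s k + h <= s k.+1 -> s k.+1 <> s k + h ->
  0 <= eta k <= etaM -> 0 <= eta k.+1 <= etaM -> T k + h <= t < T k.+1 ->
  [/\ s k + h <= t - eta_bar h s eta k t, t - eta_bar h s eta k t < s k.+1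
    & 0 <= eta_bar h s eta k t <= etaM].
Proof.
move=> h0 sk /eqP skn /andP[e0 e1] /andP[e2 e3] /andP[t0 t1].
have {sk skn}sk : s k + h < s k.+1 by rewrite lt_neqAle eq_sym skn.
rewrite /eta_bar; set a := T k; set b := T k.+1.
have d0 : 0 < b - a - h by rewrite /a /b; lra.
set p := (b - t) / (b - a - h); set q := (t - a - h) / (b - a - h).
have p0 : 0 < p by rewrite divr_gt0// /b; lra.
have q0 : 0 <= q by apply: divr_ge0; [rewrite /a; lra|exact: ltW].
have pq : p + q = 1 by rewrite /p /q; field; rewrite gt_eqF.
have tE : t = p * (a + h) + q * b by rewrite /p /q; field; rewrite gt_eqF.
have rE : t - (p * eta k + q * eta k.+1) = p * (s k + h) + q * s k.+1.
  by rewrite {1}tE /a /b /updating_time; ring.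
rewrite rE; have -> : p = 1 - q by lra.
have q1 : q < 1 by lra.
split; [nra|nra|apply/andP; split; nra].
Qed.

(** In the first phase the held instant is [s k] itself and the error is 0. In the second it lies in
    [[s k + h, s k.+1)], where the trigger has not fired, and the delay is at most [etaM]. *)
Lemma sampled_control k t (r := hold_time k t) : 0 < h ->
  closed_loop S h etaM eps Omega w v s eta x u -> T k <= t < T k.+1 ->
  [/\ 0 <= r, t - (h + etaM) <= r <= t &
   exists2 e, u t = gainK S *m (y r + e) &
     e = 0 \/ t - etaM <= r /\ qform Omega e < eps * qform Omega (y r)].
Proof.
move=> h0 [Hs He Htr [_ Hu] _] tk; have [He1 _] := He.
have /andP[t0 t1] := tk.
have [[skh trig] lb] := Htr k.
have /andP[e0 e1] := He1 k; have /andP[e2 e3] := He1 k.+1.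
have s0 := hold_time_sampling_ge0 k Hs.
have T0 : T k = s k + eta k by [].
have T1 : T k.+1 = s k.+1 + eta k.+1 by [].
rewrite /r /hold_time; case: ifPn => [H|].
  split=> //; last by exists 0; [rewrite addr0; exact: Hu|left].
  apply/andP; split; last lra.
  (* If [s k.+1 = s k + h], the bound on the delay uses [t < T k.+1] and [eta k.+1 <= etaM];
     otherwise it uses [t < T k + h]. *)
  by case/orP: H => [/eqP E|H]; lra.
rewrite negb_or -leNgt => /andP[/eqP skn tkh].
have [|r1 r2 /andP[r3 r4]] := second_phase h0 skh skn (He1 k) (He1 k.+1) (t := t).
  by rewrite tkh t1.
set rr := t - eta_bar h s eta k t in r1 r2 *.
have rt : t - etaM <= rr by rewrite /rr; lra.
split; [lra|apply/andP; split; rewrite /rr in rt *; lra|].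
exists (y (s k) - y rr); first by rewrite subrKC; exact: Hu.
right; split=> //; rewrite -qformN opprB ltNge; apply/negP => H.
(* A failure of the strict inequality would put [rr] in the trigger set below its least element
   [s k.+1]. *)
have /lb : trigger_set h eps Omega y (s k) rr by [].
by rewrite leNgt r2.
Qed.
End SampledControl.

(** * The trajectory extended to negative times *)

Section Plant.
Context {R : realType} {n m nz l nw nv : nat} (S : ncs R n m nz l nw nv).
Variables (h etaM eps : R) (Omega : 'M[R]_l).
Variables (w : R -> 'cV[R]_nw) (v : R -> 'cV[R]_nv) (s eta : nat -> R).
Variables (x : R -> 'cV[R]_n) (u : R -> 'cV[R]_m).
Notation mu := (@lebesgue_measure R).

Lemma L2_signal_cutoff p (g : R -> 'cV[R]_p) i : L2_signal g ->
  L2loc (cutoff (fun t => g t i 0)).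
Proof.
move=> [mg gi]; have mc := measurable_cutoff (mg i); split=> //.
have mD : measurable (`[0, +oo[%classic : set (measurableTypeR R)) by exact: measurable_itv.
have msq : measurable_fun (`[0, +oo[%classic : set R) (fun t => sqnorm (g t)).
  have -> : (fun t => sqnorm (g t)) = (fun t => \sum_i g t i 0 * g t i 0).
    by apply/funext => t; rewrite sqnormE dotvE.
  by apply: measurable_sum => j; apply: measurable_funM.
apply: (@locint_dominated _ _ (cutoff (fun t => sqnorm (g t)))).
- exact: measurable_funX.
- move=> a b; rewrite cutoff_patch.
  have -> : EFin \o ((fun t => sqnorm (g t)) \_ `[0, +oo[%classic) =
      (EFin \o (fun t => sqnorm (g t))) \_ `[0, +oo[%classic.
    by apply/funext => t; rewrite /= !patchE/=; case: ifP.
  have mI : measurable (`[a, b]%classic : set (measurableTypeR R)) by exact: measurable_itv.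
  apply: (integrableS _ _ (@subsetT _ _)) => //; apply/(integrable_mkcond _ mD).
  apply/integrableP; split; first exact/measurable_EFinP.
  apply: le_lt_trans gi; apply: ge0_le_integral => //=.
  + exact/measurable_EFinP/measurableT_comp.
  + exact/measurable_EFinP.
  + by move=> t _; rewrite lee_fin ger0_norm ?sqnorm_ge0.
- move=> t; rewrite /cutoff; case: ifP => _; last by rewrite expr0n normr0.
  by rewrite ger0_norm ?sqr_ge0// sqr_le_sqnorm.
Qed.

Definition plant_rhs (t : R) : 'cV[R]_n :=
  mA S *m x t + mB1 S *m w t + mB2 S *m u t.

Definition past_state (t : R) : 'cV[R]_n := x (Num.max t 0).

Definition past_rhs (t : R) : 'cV[R]_n := if 0 <= t then plant_rhs t else 0.

Lemma L2loc_control j : closed_loop S h etaM eps Omega w v s eta x u ->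
  L2loc (cutoff (fun t => u t j 0)).
Proof.
move=> [Hs He _ [Hu0 Hu] _].
pose c k := (gainK S *m measurement S x v (s k)) j 0.
have t00 : 0 <= updating_time s eta 0.
  rewrite /updating_time; have [-> _ _] := Hs.
  by rewrite add0r; have [/(_ 0%N)/andP[]] := He.
apply: (L2loc_steps (c := c) Hs He).
- move=> t tT; rewrite /cutoff; case: ifP => // t0.
  by rewrite Hu0 ?t0// mxE.
- move=> k t tk; rewrite /cutoff.
  have -> : 0 <= t.
    apply: le_trans t00 (le_trans _ (proj1 (andP tk))).
    exact: (updating_time_mono He).
  by rewrite (Hu k t tk).
Qed.

(** The right-hand side combines a continuous state, an L2 disturbance and a control with locally
    finitely many steps, so it is locally square integrable; the quadratic forms of the derivative
    inside the functional rely on this. *)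
Lemma past_stateP i : L2_signal w -> closed_loop S h etaM eps Omega w v s eta x u ->
  primitive (fun t => past_state t i 0) (fun t => past_rhs t i 0) /\
  L2loc (fun t => past_rhs t i 0).
Proof.
move=> w2 Hcl; have [cx Hx] := cl_plant Hcl.
pose g t := \sum_j mA S i j * past_state t j 0
  + \sum_j mB1 S i j * cutoff (fun t => w t j 0) t + \sum_j mB2 S i j * cutoff (fun t => u t j 0) t.
have g2 : L2loc g.
  apply: L2locD; [apply: L2locD|]; apply: L2loc_sum => j; apply: L2locZ.
  - apply: L2loc_continuous => t.
    apply: (@continuous_comp _ _ _ past_state (fun M : 'cV[R]_n => M j 0)).
      exact: continuous_clip.
    exact: coord_continuous.
  - exact: L2_signal_cutoff.
  - exact: L2loc_control.
have gE t : 0 <= t -> plant_rhs t i 0 = g t.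
  move=> t0; rewrite /plant_rhs !mxE /g.
  congr (_ + _ + _); apply: eq_bigr => j _.
  - by rewrite /past_state max_l.
  - by rewrite /cutoff t0.
  - by rewrite /cutoff t0.
have fE : cutoff g = (fun t => past_rhs t i 0).
  apply/funext => t; rewrite /cutoff /past_rhs; case: ifP => [/gE//|_].
  by rewrite mxE.
rewrite -fE; split; last exact: L2loc_cutoff.
apply: (primitive_cutoff (F := fun t => x t i 0)); first exact: L2loc_locint.
move=> t t0; rewrite (Hx t i t0); congr (_ + _).
by apply: eq_Rintegral => r; rewrite inE/= in_itv/= => /andP[r0 _]; exact: gE.
Qed.

End Plant.

(** * Comparison and strict negativity of improper integrals *)

Section UpperIntegral.
Context {R : realType}.
Notation mu := (@lebesgue_measure R).

(** The function [f] is only measurable and its integral may be -oo, so the comparison is made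
    separately on positive and negative parts. *)
Lemma le_integral_Rintegral (D : set (measurableTypeR R)) (f g : R -> R) :
  measurable D -> measurable_fun D f -> mu.-integrable D (EFin \o g) ->
  (forall t, D t -> f t <= g t) ->
  (\int[mu]_(t in D) (f t)%:E <= (\int[mu]_(t in D) g t)%R%:E)%E.
Proof.
move=> mD mf gi fg.
have mg : measurable_fun D (EFin \o g) by exact: measurable_int gi.
have {}mf : measurable_fun D (EFin \o f) by exact/measurable_EFinP.
have gfin := integrable_fin_num mD gi.
rewrite /Rintegral fineK// [leLHS]integralE [leRHS]integralE.
apply: leeB; apply: ge0_le_integral => //=.
- exact: measurable_funepos.
- exact: measurable_funepos.
- by move=> t Dt; rewrite !funeposE /= le_max2 // ?lee_fin ?fg.
- exact: measurable_funeneg.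
- exact: measurable_funeneg.
- by move=> t Dt; rewrite !funenegE /= le_max2 // lee_fin lerN2 fg.
Qed.

Lemma limf_esup_pinfty_lt0 (f : R -> \bar R) (a : R) (e : \bar R) :
  (forall t, a < t -> (f t <= e)%E) -> (e < 0)%E -> (limf_esup f (+oo_R) < 0)%E.
Proof.
move=> H e0; apply: le_lt_trans e0; apply: ge_ereal_inf.
exists (ereal_sup [set f t | t in [set t | a < t]]).
  by exists [set t | a < t] => //; exists a; split=> //; exact: num_real.
by apply: ge_ereal_sup => _ [t at_ <-]; exact: H.
Qed.

(** The integrals over [[0, T]] decrease with [T], so one negative value bounds the upper limit. If
    none of those over [[0, N]] is negative, then [g] vanishes almost everywhere on each [[0, N]],
    hence on the half-line. *)
Lemma upper_improper_integral_lt0 (g : R -> R) :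
  measurable_fun (`[0, +oo[%classic : set R) g -> (forall t, 0 <= t -> g t <= 0) ->
  ~ {ae mu, forall t : R, 0 <= t -> g t = 0} -> (upper_improper_integral g < 0)%E.
Proof.
move=> mg g0 gn.
have mI T : measurable (`[0, T]%classic : set (measurableTypeR R)) by exact: measurable_itv.
have mgT T : measurable_fun (`[0, T]%classic : set R) (fun t => - g t).
  by apply: measurable_funS (measurable_funN mg) => //; apply: subset_itvl.
have G0 T t : `[0, T]%classic t -> (0 <= (- g t)%:E)%E.
  by rewrite /= in_itv/= lee_fin oppr_ge0 => /andP[/g0].
have GE T : (\int[mu]_(t in `[0%R, T]) (g t)%:E = - \int[mu]_(t in `[0%R, T]) (- g t)%:E)%E.
  rewrite -integral_ge0N; last exact: G0.
  by apply: eq_integral => t _; rewrite -EFinN opprK.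
have [[N NE]|H] := pselect (exists N : nat, (\int[mu]_(t in `[0%R, N%:R]) (g t)%:E < 0)%E).
  apply: (limf_esup_pinfty_lt0 (a := N%:R)) NE => T NT.
  rewrite !GE leeN2; apply: ge0_subset_integral => //.
  - by apply/measurable_EFinP; exact: mgT.
  - exact: G0.
  - by apply: subset_itvl; rewrite bnd_simp ltW.
exfalso; apply: gn.
have ae0 (N : nat) : {ae mu, forall t : R, `[0, N%:R]%classic t -> (g t)%:E = 0%E}.
  have : (\int[mu]_(t in `[0%R, N%:R]) `| (g t)%:E | = 0)%E.
    have -> : (\int[mu]_(t in `[0%R, N%:R]) `| (g t)%:E | =
        \int[mu]_(t in `[0%R, N%:R]) (- g t)%:E)%E.
      apply: eq_integral => t; rewrite inE/= in_itv/= => /andP[t0 _].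
      by rewrite ler0_norm ?g0.
    apply/eqP; rewrite eq_le integral_ge0 ?andbT; last exact: G0.
    rewrite leNgt; apply/negP => I0; apply: H; exists N.
    by rewrite GE oppe_lt0.
  have mf : measurable_fun (`[0, N%:R]%classic : set R) (EFin \o g).
    apply/measurable_EFinP.
    by apply: eq_measurable_fun (measurable_funN (mgT N%:R)) => t _ /=; rewrite opprK.
  exact: (iffLR (ae_eq_integral_abs mu (mI N%:R) mf)).
apply: negligibleS (negligible_bigcup ae0) => t /= /not_implyP[t0 gt0].
exists (Num.trunc t).+1 => //= Ht; apply: gt0.
have [] // : g t = 0 /\ True; split=> //.
by apply: EFin_inj; apply: Ht; rewrite in_itv/= t0 ltW// truncnS_gt.
Qed.
End UpperIntegral.

(** * Measurability of the output and of the delayed noise *)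

Section SignalMeasurability.
Context {R : realType} {n m nz l nw nv : nat} (S : ncs R n m nz l nw nv).
Variables (h etaM eps : R) (Omega : 'M[R]_l).
Variables (w : R -> 'cV[R]_nw) (v : R -> 'cV[R]_nv) (s eta : nat -> R).
Variables (x : R -> 'cV[R]_n) (u : R -> 'cV[R]_m) (tau : R -> R).
Notation D := (`[0, +oo[%classic : set R).
Notation T := (updating_time s eta).

Lemma measurable_sqnorm p (A : set R) (f : R -> 'cV[R]_p) :
  (forall i, measurable_fun A (fun t => f t i 0)) ->
  measurable_fun A (fun t => sqnorm (f t)).
Proof.
move=> mf; have -> : (fun t => sqnorm (f t)) = (fun t => \sum_i f t i 0 * f t i 0).
  by apply/funext => t; rewrite sqnormE dotvE.
by apply: measurable_sum => j; exact: measurable_funM.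
Qed.

Lemma measurable_mulmx p q (M : 'M[R]_(p, q)) (A : set R) (f : R -> 'cV[R]_q) i :
  (forall j, measurable_fun A (fun t => f t j 0)) ->
  measurable_fun A (fun t => (M *m f t) i 0).
Proof.
move=> mf; have -> : (fun t => (M *m f t) i 0) = (fun t => \sum_j M i j * f t j 0).
  by apply/funext => t; rewrite mxE.
by apply: measurable_sum => j; exact: measurable_funM.
Qed.

Lemma measurable_hold_time k : measurable_fun [set: R] (hold_time h s eta k).
Proof.
apply: measurable_fun_ifT => //.
- apply: measurable_or => //; apply: measurable_fun_ltr => //.
- set d := (T k.+1 - T k - h)^-1.
  have -> : (fun t => t - eta_bar h s eta k t) = (fun t =>
      (1 + d * (eta k - eta k.+1)) * t + d * ((T k + h) * eta k.+1 - T k.+1 * eta k)).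
    by apply/funext => t; rewrite /eta_bar -/d; ring.
  by apply: measurable_funD => //; exact: measurable_funM.
Qed.

Lemma measurable_delayed_noise i : L2_signal v -> is_tau h s eta tau -> 0 < h ->
  closed_loop S h etaM eps Omega w v s eta x u ->
  measurable_fun [set: R] (fun t => delayed_noise s eta tau v t i 0).
Proof.
move=> [mv _] Htau h0 Hcl; have Hs := cl_sampling Hcl; have He := cl_delays Hcl.
apply: (measurable_steps Hs He) => [t tT|k]; first by rewrite /delayed_noise tT mxE.
(* The noise is measurable on the half-line only; held instants are nonnegative, so [v] may be
   replaced by its cutoff before composing. *)
apply: (eq_measurable_fun (fun t => cutoff (fun r => v r i 0) (hold_time h s eta k t))).
  move=> t; rewrite inE/= in_itv/= => tk.
  have [r0 _ _] := sampled_control h0 Hcl tk.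
  rewrite /cutoff r0 /delayed_noise (is_tau_hold_time Htau tk) ltNge.
  by rewrite (le_trans _ (proj1 (andP tk)))// (updating_time_mono He).
apply: measurable_funTS; apply: measurableT_comp; last exact: measurable_hold_time.
exact: measurable_cutoff.
Qed.

Lemma measurable_from_cutoff (g : R -> R) : measurable_fun [set: R] (cutoff g) ->
  measurable_fun D g.
Proof.
move=> mg; apply: eq_measurable_fun (measurable_funTS mg) => t.
by rewrite inE/= in_itv/= andbT /cutoff => ->.
Qed.

Lemma measurable_output i : {within `[0, +oo[, continuous x} ->
  closed_loop S h etaM eps Omega w v s eta x u ->
  measurable_fun D (fun t => (mC1 S *m x t + mD1 S *m u t) i 0).
Proof.
move=> cx Hcl.
have -> : (fun t => (mC1 S *m x t + mD1 S *m u t) i 0) =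
    (fun t => (mC1 S *m x t) i 0 + (mD1 S *m u t) i 0).
  by apply/funext => t; rewrite mxE.
apply: measurable_funD; apply: measurable_mulmx => j; apply: measurable_from_cutoff.
- have [mx _] : L2loc (cutoff (fun t => past_state x t j 0)).
    apply: L2loc_cutoff; apply: L2loc_continuous => t.
    apply: (@continuous_comp _ _ _ (past_state x) (fun M : 'cV[R]_n => M j 0)).
      exact: continuous_clip.
    exact: coord_continuous.
  have -> // : cutoff (fun t => x t j 0) = cutoff (fun t => past_state x t j 0).
  by apply/funext => t; rewrite /cutoff; case: ifP => // t0; rewrite /past_state max_l.
- exact: (L2loc_control j Hcl).1.
Qed.

End SignalMeasurability.

(** * Dissipation inequality, exponential stability and L2-gain *)

Section Dissipation.
Context {R : realType} {n m nz l nw nv : nat} (S : ncs R n m nz l nw nv).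
Variables (gamma h etaM eps delta : R).
Variables (P S0 S1 R0 R1 G0 G1 : 'M[R]_n) (Omega : 'M[R]_l).
Hypotheses (P_posdef : posdef P).
Hypotheses (S0_psd : possemidef S0) (S1_psd : possemidef S1).
Hypotheses (R0_psd : possemidef R0) (R1_psd : possemidef R1) (Omega_psd : possemidef Omega).
Hypothesis Psi_le0 : negsemidef (lmiPsi S gamma h etaM delta P S0 S1 R0 R1 G1).
Hypothesis Phi_le0 : negsemidef (lmiPhi S gamma h etaM eps delta P S0 S1 R0 R1 G0 Omega).
Hypotheses (G0_ge0 : possemidef (symblock R0 G0 R0)) (G1_ge0 : possemidef (symblock R1 G1 R1)).

Notation rate := (lk_rate h etaM delta P S0 S1 R0 R1).
Notation a := (expR (- (2 * delta * etaM))).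
Notation b := (expR (- (2 * delta * (h + etaM)))).

Lemma Psi_rate x1 x2 x3 x4 (w : 'cV[R]_nw) (v : 'cV[R]_nv)
    (u := gainK S *m (mC2 S *m x4 + mD2 S *m v)) :
  rate x1 x2 x3 (mA S *m x1 + mB1 S *m w + mB2 S *m u)
  - a * qform R0 (x1 - x2)
  - b * (qform R1 (x2 - x4) + qform R1 (x4 - x3) + 2 * dotv (x2 - x4) (G1 *m (x4 - x3)))
  <= gamma ^+ 2 * (sqnorm w + sqnorm v) - sqnorm (mC1 S *m x1 + mD1 S *m u).
Proof.
rewrite /u !mulmxA.
set f := mA S *m x1 + _ + _; set z := mC1 S *m x1 + _.
have := Psi_le0.2 (col_mx x1 (col_mx x2 (col_mx x3 (col_mx x4 (col_mx w (col_mx v f)))))).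
rewrite lmiPsi_qform; [|exact: P_posdef.1|exact: R0_psd.1|exact: R1_psd.1].
rewrite -/f -/z /lk_rate (qformE (_ + _) f); lra.
Qed.

Lemma Phi_rate x1 x2 x3 x4 e (w : 'cV[R]_nw) (v : 'cV[R]_nv)
    (r := mC2 S *m x4 + mD2 S *m v) (u := gainK S *m (r + e)) :
  rate x1 x2 x3 (mA S *m x1 + mB1 S *m w + mB2 S *m u)
  - a * (qform R0 (x1 - x4) + qform R0 (x4 - x2) + 2 * dotv (x1 - x4) (G0 *m (x4 - x2)))
  - b * qform R1 (x2 - x3)
  <= gamma ^+ 2 * (sqnorm w + sqnorm v) - sqnorm (mC1 S *m x1 + mD1 S *m u)
     + (qform Omega e - eps * qform Omega r).
Proof.
rewrite /u (mulmxA (mB2 S)) (mulmxA (mD1 S)).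
set f := mA S *m x1 + _ + _; set z := mC1 S *m x1 + _.
have := Phi_le0.2 (col_mx x1 (col_mx x2 (col_mx x3 (col_mx x4 (col_mx e (col_mx w (col_mx v f))))))).
rewrite lmiPhi_qform; [|exact: P_posdef.1|exact: R0_psd.1|exact: R1_psd.1|exact: Omega_psd.1].
rewrite -/f -/z -/r /lk_rate (qformE (_ + _) f); lra.
Qed.

(** This serves trajectories that stay at 0, where the functional yields no strict decrease. *)
Lemma Phi_zero_state e (w : 'cV[R]_nw) (v : 'cV[R]_nv) :
  sqnorm (mD1 S *m (gainK S *m (mD2 S *m v + e))) - gamma ^+ 2 * (sqnorm w + sqnorm v)
  + eps * qform Omega (mD2 S *m v) - qform Omega e <= 0.
Proof.
have := Phi_le0.2 (col_mx 0 (col_mx 0 (col_mx 0 (col_mx 0 (col_mx e (col_mx w (col_mx v 0))))))).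
rewrite lmiPhi_qform; [|exact: P_posdef.1|exact: R0_psd.1|exact: R1_psd.1|exact: Omega_psd.1].
by rewrite !mulmx0 !subr0 !add0r !dotv0l !dotv0r !qform0 mulmxA; lra.
Qed.

(* Although Phi is only semidefinite, its (v, v) block is definite: perturbing
   (0, v) along e = k D2 v would otherwise make the form positive. *)
Lemma zero_state_strict (w : 'cV[R]_nw) (v : 'cV[R]_nv) : 0 < gamma -> 0 <= eps ->
  let g := sqnorm (mD1 S *m (gainK S *m (mD2 S *m v)))
           - gamma ^+ 2 * (sqnorm w + sqnorm v) in
  0 <= g -> sqnorm w + sqnorm v = 0.
Proof.
move=> g0 eps0 /=; set X := sqnorm (mD1 S *m _); set q := qform Omega (mD2 S *m v).
have q0 : 0 <= q by exact: Omega_psd.2.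
have X0 : 0 <= X by exact: sqnorm_ge0.
have w0 := sqnorm_ge0 w; have v0 := sqnorm_ge0 v.
have g2 : 0 < gamma ^+ 2 by rewrite exprn_gt0.
have K k : (1 + k) ^+ 2 * X - gamma ^+ 2 * sqnorm v + eps * q - k ^+ 2 * q <= 0.
  have := Phi_zero_state (k *: (mD2 S *m v)) 0 v.
  rewrite -[X in X + k *: _]scale1r -scalerDl -!scalemxAr !sqnormE dotvZl dotvZr.
  by rewrite dotv0l qformZ -/q -!sqnormE -/X; lra.
move=> Xg; have Xle0 : X <= 0.
  rewrite leNgt; apply/negP => Xpos.
  have gw : 0 <= gamma ^+ 2 * sqnorm w by rewrite mulr_ge0// ltW.
  have eq0 : 0 <= eps * q by rewrite mulr_ge0.
  have q1 : 0 < q + 1 by lra.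
  (* For this [k] one has [k * q < X], so the first-order gain [2 * k * X] outweighs the cost
     [k ^+ 2 * q]. *)
  have := K (X / (q + 1)); set k := X / (q + 1) => Kk.
  have k0 : 0 < k by rewrite divr_gt0.
  have kX : k * q + k = X by rewrite /k; field; rewrite gt_eqF.
  have : k * (2 * X + k * X - k * q) <= 0.
    by move: Kk gw eq0 Xg => ????; lra.
  by rewrite pmulr_rle0//; have := mulr_gt0 k0 Xpos => ??; lra.
have : gamma ^+ 2 * (sqnorm w + sqnorm v) <= 0 by lra.
rewrite pmulr_rle0// => ?; apply/eqP; rewrite eq_le; apply/andP; split=> //; lra.
Qed.

Section Trajectory.
Variables (w : R -> 'cV[R]_nw) (v : R -> 'cV[R]_nv) (s eta : nat -> R).
Variables (x : R -> 'cV[R]_n) (u : R -> 'cV[R]_m).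
Notation T := (updating_time s eta).
Notation X := (past_state x).
Notation z t := (mC1 S *m x t + mD1 S *m u t).

Lemma dissipation : 0 < h -> 0 <= etaM -> 0 <= eps -> 0 <= delta ->
  L2_signal w -> closed_loop S h etaM eps Omega w v s eta x u ->
  exists W omega : R -> R,
  [/\ primitive W omega,
   forall t, expR (2 * delta * t) * qform P (X t) <= W t,
   W 0 <= qform P (x 0) + etaM * qform S0 (x 0) + h * qform S1 (x 0),
   forall t, omega t <= expR (2 * delta * t) *
     rate (X t) (X (t - etaM)) (X (t - (h + etaM))) (past_rhs S w x u t) &
   (forall k t, T k <= t < T k.+1 -> omega t <= expR (2 * delta * t) *
     (gamma ^+ 2 * (sqnorm (w t) + sqnorm (v (hold_time h s eta k t))) - sqnorm (z t)))
   /\ (x 0 = 0 -> forall t, 0 <= t < T 0%N -> omega t <= expR (2 * delta * t) *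
     (gamma ^+ 2 * sqnorm (w t) - sqnorm (z t)))].
Proof.
move=> h0 etaM0 eps0 delta0 w2 Hcl.
have xf i := (past_stateP i w2 Hcl).1; have f2 i := (past_stateP i w2 Hcl).2.
have [W [om [Wp Wlow W0 Wrate]]] := lyapunov_krasovskii xf f2 P_posdef.1 S0_psd S1_psd
  R0_psd R1_psd G0_ge0 G1_ge0 (ltW h0) etaM0 delta0.
have X0 t : t <= 0 -> X t = x 0 by move=> t0; rewrite /past_state max_r.
have Xx t : 0 <= t -> X t = x t by move=> t0; rewrite /past_state max_l.
have F0 t : 0 <= t -> past_rhs S w x u t = mA S *m x t + mB1 S *m w t + mB2 S *m u t.
  by move=> t0; rewrite /past_rhs t0.
have Hs := cl_sampling Hcl; have He := cl_delays Hcl.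
have T00 : 0 <= T 0%N.
  have [s00 _ _] := Hs; have [/(_ 0%N)/andP[e0 _] _] := He.
  by rewrite /updating_time s00 add0r.
have T0M : T 0%N <= etaM.
  have [s00 _ _] := Hs; have [/(_ 0%N)/andP[_ e0] _] := He.
  by rewrite /updating_time s00 add0r.
have mono t y1 y2 : y1 <= y2 -> expR (2 * delta * t) * y1 <= expR (2 * delta * t) * y2.
  by exact: (ler_wpM2l (expR_ge0 _)).
exists W, om; split=> //.
- apply: W0 => // t t0; by rewrite /past_rhs leNgt t0.
- by move=> t; have [] := Wrate t.
split=> [k t tk|x00 t /andP[t0 tT]].
- have t0 : 0 <= t.
    apply: le_trans T00 (le_trans _ (proj1 (andP tk))).
    exact: (updating_time_mono He).
  have [r0 /andP[r1 r2] [e ue He']] := sampled_control h0 Hcl tk.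
  set r := hold_time _ _ _ _ _ in r0 r1 r2 ue He' *.
  have [_ WPhi WPsi] := Wrate t.
  rewrite F0// Xx// ue /measurement in WPhi WPsi.
  rewrite ue /measurement.
  have Oe : 0 <= eps * qform Omega (mC2 S *m x r + mD2 S *m v r).
    by rewrite mulr_ge0//; exact: Omega_psd.2.
  have [tr|tr] := leP (t - etaM) r.
    apply: le_trans (WPhi r _) _; first by rewrite tr.
    rewrite (Xx r)//; apply: mono.
    apply: le_trans (Phi_rate _ _ _ _ _ _ _) _.
    rewrite gerDl; case: He' => [->|[_ He']].
      by rewrite qform0 sub0r oppr_le0.
    by rewrite subr_le0 ltW.
  (* A delay above [etaM] excludes the second phase, so the trigger error is 0 and [Psi] applies. *)
  case: He' => [e0|[]]; last by rewrite leNgt tr.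
  rewrite e0 addr0 in WPsi *.
  apply: le_trans (WPsi r _) _; first by rewrite r1 ltW.
  by rewrite (Xx r)//; apply: mono; exact: Psi_rate.
- have [_ WPhi _] := Wrate t.
  have te : t - etaM <= 0 by lra.
  (* Since t < t_0 <= [etaM], this instant lies in the extended past, where the state is
     [x 0 = 0]. *)
  have := WPhi (t - etaM).
  rewrite F0// Xx// !(X0 _ te) x00 !lexx.
  have [u0 _] := cl_control Hcl.
  rewrite u0 ?t0//.
  move=> /(_ _)/le_trans; apply; first by apply/andP; split=> //; lra.
  apply: mono.
  have := Phi_rate (x t) 0 (X (t - (h + etaM))) 0 0 (w t) 0.
  have n0 : sqnorm (0 : 'cV[R]_nv) = 0 by exact: dotv0l.
  by rewrite /= !mulmx0 !addr0 !mulmx0 !addr0 !qform0 n0; lra.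
Qed.

End Trajectory.

Lemma L2_signal0 p : L2_signal (fun=> 0 : 'cV[R]_p).
Proof.
split=> [i|]; first exact: measurable_cst.
rewrite (_ : (fun=> _) = (fun=> 0%E)) ?integral0//.
by apply/funext => t; rewrite sqnormE dotv0l.
Qed.

(** Before the first update x' = A x, so the squared norm times [expR (- (2 * c) * t)] does not
    increase. *)
Lemma zero_input_growth (s eta : nat -> R) (x : R -> 'cV[R]_n) (u : R -> 'cV[R]_m) c t :
  (forall y, qform (mA S) y <= c * sqnorm y) ->
  closed_loop S h etaM eps Omega (fun=> 0) (fun=> 0) s eta x u ->
  0 <= t <= updating_time s eta 0 ->
  sqnorm (x t) <= expR (2 * c * t) * sqnorm (x 0).
Proof.
move=> Hc Hcl /andP[t0 tT].
have xf i := (past_stateP i (@L2_signal0 nw) Hcl).1.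
have N1 (y : 'cV[R]_n) : qform 1%:M y = sqnorm y by rewrite qformE mul1mx.
have Np := primitiveM (primitive_expRM (- (2 * c)))
  (primitive_qform xf (@trmx1 R n)).
have [u0 _] := cl_control Hcl.
have := primitive_le_bound (k := 0) Np t0.
rewrite mul0r mulr0 expR0 mul1r !N1 /past_state maxxx (max_l t0) => H.
rewrite -ler_pdivrMl ?expR_gt0// -expRN -subr_le0 -mulNr; apply: H => r /andP[r0 rt].
rewrite N1 /past_rhs r0 /plant_rhs max_l// u0 ?r0 ?(lt_le_trans rt)//.
rewrite !mulmx0 !addr0 mul1mx -qformE.
have := Hc (x r); have := expR_gt0 (- (2 * c) * r); nra.
Qed.

Lemma exponential_stability : 0 < h -> 0 <= etaM -> 0 <= eps -> 0 <= delta ->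
  int_exp_stable S h etaM eps Omega delta.
Proof.
move=> h0 etaM0 eps0 delta0.
have [cP cP0 HcP] := sqnorm_le_posdef P_posdef.
have [cA cA0 HcA] := qform_le_sqnorm (mA S).
(* With f = A x, [c1] bounds the terms of the rate in the current state, [c2] the delayed [S1] term,
   and [c3] the initial value of the functional. *)
have [c1 c10 Hc1] := qform_le_sqnorm (2 *: (P *m mA S) + (2 * delta) *: P + S0
  + (mA S)^T *m (etaM ^+ 2 *: R0 + h ^+ 2 *: R1) *m mA S).
have [c2 c20 Hc2] := qform_le_sqnorm S1.
have [c3 c30 Hc3] := qform_le_sqnorm (P + etaM *: S0 + h *: S1).
(* On [[0, t_0]], contained in [[0, etaM]], [kappa] bounds the growth of the squared norm, [K] the
   rate of the functional and [C] the functional itself, all relative to [sqnorm (x 0)]. *)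
pose kappa := expR (2 * cA * etaM).
have kappa1 : 1 <= kappa by rewrite -expR0 ler_expR !mulr_ge0.
pose K := expR (2 * delta * etaM) * ((c1 + c2) * kappa).
have K0 : 0 <= K by rewrite !mulr_ge0 ?expR_ge0//; lra.
pose C := c3 + K * etaM.
have C0 : 0 <= C by rewrite addr_ge0// mulr_ge0.
(* The added 1 makes the constant positive even if [C] is 0. *)
exists (Num.sqrt (cP * C) + 1) => [|s eta x u Hcl t t0].
  by rewrite ltr_wpDl// sqrtr_ge0.
have [W [om [Wp Wlow W0 Wrate [Wphase _]]]] :=
  dissipation h0 etaM0 eps0 delta0 (@L2_signal0 nw) Hcl.
set T := updating_time s eta in Wphase.
have He := cl_delays Hcl; have Hs := cl_sampling Hcl.
have [[s00 _ _] [/(_ 0%N)/andP[e00 e0M] _]] := (Hs, He).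
have T00 : 0 <= T 0%N by rewrite /T /updating_time s00 add0r.
have T0M : T 0%N <= etaM by rewrite /T /updating_time s00 add0r.
have N0 := sqnorm_ge0 (x 0).
have growth r : 0 <= r <= T 0%N -> sqnorm (x r) <= kappa * sqnorm (x 0).
  move=> r0T; apply: le_trans (zero_input_growth HcA Hcl r0T) _.
  rewrite ler_wpM2r// ler_expR ler_wpM2l ?mulr_ge0//.
  by have /andP[_ rT] := r0T; exact: le_trans rT T0M.
have [u0 _] := cl_control Hcl.
have init r : 0 <= r < T 0%N -> om r <= K * sqnorm (x 0).
  move=> /andP[r0 rT]; apply: le_trans (Wrate r) _.
  have x1 : past_state x r = x r by rewrite /past_state max_l.
  have x2 : past_state x (r - etaM) = x 0 by rewrite /past_state max_r//; lra.
  rewrite x1 x2 /past_rhs r0 /plant_rhs u0 ?r0// !mulmx0 !addr0.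
  have B : rate (x r) (x 0) (past_state x (r - (h + etaM))) (mA S *m x r)
      <= (c1 + c2) * kappa * sqnorm (x 0).
    have := Hc1 (x r); rewrite !qformD !qform_scalel.
    have -> : qform (P *m mA S) (x r) = dotv (x r) (P *m (mA S *m x r)).
      by rewrite qformE mulmxA.
    set H := _ + h ^+ 2 *: R1.
    have -> : qform ((mA S)^T *m H *m mA S) (x r) = qform H (mA S *m x r).
      by rewrite !qformE -!mulmxA dotv_tr.
    rewrite /lk_rate -/H => h1.
    have a1 : a <= 1 by rewrite -expR0 ler_expR oppr_le0 !mulr_ge0.
    have h2 : a * qform S1 (x 0) <= c2 * sqnorm (x 0).
      by apply: le_trans (Hc2 _); rewrite ler_piMl//; exact: S1_psd.2.
    have h3 : 0 <= a * qform S0 (x 0) by rewrite mulr_ge0 ?expR_ge0//; exact: S0_psd.2.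
    have h4 : 0 <= b * qform S1 (past_state x (r - (h + etaM))).
      by rewrite mulr_ge0 ?expR_ge0//; exact: S1_psd.2.
    have h5 : c1 * sqnorm (x r) <= c1 * (kappa * sqnorm (x 0)).
      by apply: ler_wpM2l => //; apply: growth; rewrite r0 ltW.
    have h6 : c2 * sqnorm (x 0) <= c2 * (kappa * sqnorm (x 0)).
      by apply: ler_wpM2l => //; rewrite ler_peMl.
    by move: h1 h2 h3 h4 h5 h6; lra.
  have B0 : 0 <= (c1 + c2) * kappa * sqnorm (x 0).
    by rewrite !mulr_ge0 ?expR_ge0// addr_ge0.
  apply: le_trans (ler_wpM2l (expR_ge0 _) B) _.
  rewrite /K -(mulrA (expR _)); apply: ler_wpM2r => //.
  by rewrite ler_expR ler_wpM2l ?mulr_ge0// (le_trans (ltW rT)).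
have WT0 r : 0 <= r <= T 0%N -> W r <= C * sqnorm (x 0).
  move=> /andP[r0 rT].
  have := primitive_le_bound Wp r0 (k := K * sqnorm (x 0)).
  rewrite subr0 => /(_ _) H.
  have {}H : W r - W 0 <= K * sqnorm (x 0) * r.
    by apply: H => q /andP[q0 qr]; apply: init; rewrite q0 (lt_le_trans qr).
  have : K * sqnorm (x 0) * r <= K * sqnorm (x 0) * etaM.
    by apply: ler_wpM2l; [exact: mulr_ge0|exact: le_trans rT T0M].
  have := Hc3 (x 0); rewrite !qformD !qform_scalel => h3.
  by rewrite /C; lra.
have Wt : W t <= C * sqnorm (x 0).
  have [tT|/ltW tT] := leP t (T 0%N); first by apply: WT0; rewrite t0.
  (* After the first update, with zero disturbances, the rate is at most a negative multiple of the
     squared output, so the weighted functional does not increase. *)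
  apply: le_trans (WT0 (T 0%N) _); last by rewrite T00 lexx.
  rewrite -subr_le0 -(mul0r (t - T 0%N)); apply: (primitive_le_bound Wp) => // r /andP[Tr _].
  have [k rk] := updating_time_cover Hs He Tr.
  apply: le_trans (Wphase k r rk) _.
  rewrite sqnormE dotv0l sqnormE dotv0l addr0 mulr0 sub0r mulrN oppr_le0.
  by rewrite mulr_ge0 ?expR_ge0 ?sqnorm_ge0.
have := Wlow t; rewrite /past_state max_l// => /le_trans /(_ Wt) Wx.
have Nx : sqnorm (x t) <= cP * C * expR (- (delta * t)) ^+ 2 * sqnorm (x 0).
  have E : expR (2 * delta * t) * expR (- (delta * t)) ^+ 2 = 1.
    by rewrite expr2 -!expRD -[RHS]expR0; congr expR; ring.
  apply: le_trans (HcP (x t)) _; rewrite -!mulrA ler_pM2l//.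
  have e2 : 0 < expR (- (delta * t)) ^+ 2 by rewrite exprn_gt0// expR_gt0.
  have := ler_wpM2r (ltW e2) Wx.
  rewrite mulrAC E mul1r => H; apply: le_trans H _.
  by rewrite expr2 -!mulrA [X in C * X]mulrC -!mulrA.
have CP0 : 0 <= cP * C by rewrite mulr_ge0// ltW.
rewrite /enorm; apply: le_trans (ler_wsqrtr Nx) _.
have E0 : 0 <= cP * C * expR (- (delta * t)) ^+ 2 by rewrite mulr_ge0 ?sqr_ge0.
rewrite (sqrtrM _ E0) (sqrtrM _ CP0) sqrtr_sqr (ger0_norm (expR_ge0 _)).
by rewrite ler_wpM2r ?sqrtr_ge0// ler_wpM2r ?expR_ge0// lerDl.
Qed.

Lemma L2_gain : 0 < gamma -> 0 < h -> 0 <= etaM -> 0 <= eps -> 0 < delta ->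
  L2_gain_lt S h etaM eps Omega gamma.
Proof.
move=> g0 h0 etaM0 eps0 delta0 w v s eta x u tau w2 v2 Hcl Htau x00 z d dne0.
pose g t := sqnorm (z t) - gamma ^+ 2 * d t.
have [cx _] := cl_plant Hcl.
have He := cl_delays Hcl; have Hs := cl_sampling Hcl; have [u0 _] := cl_control Hcl.
have mg : measurable_fun (`[0, +oo[%classic : set R) g.
  apply: measurable_funB.
    by apply: measurable_sqnorm => i; exact: (measurable_output _ cx Hcl).
  apply: measurable_funM => //; apply: measurable_funD; apply: measurable_sqnorm => i.
    by have [mw _] := w2; exact: mw.
  by apply: measurable_funTS; exact: (measurable_delayed_noise _ v2 Htau h0 Hcl).
have noise0 t : t < updating_time s eta 0 -> d t = sqnorm (w t).
  by move=> tT; rewrite /d /delayed_noise tT (_ : sqnorm 0 = 0) ?addr0//; exact: dotv0l.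
have noiseT k t : updating_time s eta k <= t < updating_time s eta k.+1 ->
    d t = sqnorm (w t) + sqnorm (v (hold_time h s eta k t)).
  move=> tk; rewrite /d /delayed_noise (is_tau_hold_time Htau tk) ltNge.
  by rewrite (le_trans _ (proj1 (andP tk)))// (updating_time_mono He).
have [[t1 [t10 xt1]]|xne] := pselect (exists t1, 0 <= t1 /\ x t1 != 0).
- have [W [om [Wp Wlow W0 _ [Wphase Winit]]]] :=
    dissipation h0 etaM0 eps0 (ltW delta0) w2 Hcl.
  rewrite x00 !qform0 !mulr0 !addr0 in W0.
  have eK t : expR (- (2 * delta) * t) * expR (2 * delta * t) = 1.
    by rewrite -expRD -[RHS]expR0; congr expR; ring.
  have gle t : 0 <= t -> g t <= - (expR (- (2 * delta) * t) * om t).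
    move=> t0; have : om t <= expR (2 * delta * t) * (- g t).
      have [tT|tT] := ltP t (updating_time s eta 0).
        by rewrite /g noise0// opprB; apply: Winit => //; rewrite t0.
      have [k tk] := updating_time_cover Hs He tT.
      by rewrite /g (noiseT k)// opprB; exact: Wphase.
    move=> /(ler_wpM2l (expR_ge0 (- (2 * delta) * t))).
    by rewrite mulrA eK mul1r; lra.
  have Vp := primitiveM (primitive_expRM (- (2 * delta))) Wp.
  set V := (fun t => expR _ * W t) in Vp.
  have cV := primitive_continuous Vp.
  have [U Up] := primitive_ex (locint_continuous cV).
  (* Removing the weight: V' = e^(-2 delta t) omega - 2 delta V, so adding [2 * delta] times a
     primitive of [V] leaves exactly the bound on the integrand of J. *)
  have Qp : primitive (fun t => V t + 2 * delta * U t) (fun t => expR (- (2 * delta) * t) * om t).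
    by apply: eq_primitive (primitiveD Vp (primitiveZ (2 * delta) Up)) => t //; rewrite /V; ring.
  have qP t : 0 <= qform P (past_state x t) by exact: (posdef_psd P_posdef).2.
  have V0 t : 0 <= V t.
    by rewrite mulr_ge0 ?expR_ge0// (le_trans _ (Wlow t))// mulr_ge0 ?expR_ge0.
  have V00 : V 0 <= 0 by rewrite /V mulr0 expR0 mul1r.
  have Vt1 : 0 < V t1.
    rewrite mulr_gt0 ?expR_gt0// (lt_le_trans _ (Wlow t1))// mulr_gt0 ?expR_gt0//.
    by rewrite /past_state max_l//; exact: P_posdef.2.
  have [b b0 Vb] : exists2 b : R, 0 < b & forall t, `|t - t1| < b -> V t1 / 2 <= V t.
    have [|b b0 Vb] := @continuous_near R V t1 (V t1 / 2) (cV t1); first by rewrite divr_gt0.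
    by exists b => // t /Vb; rewrite ltr_distl => /andP[? _]; lra.
  (* [V] stays above [V t1 / 2] on [[t1, t1 + b / 2]], so [c] is a margin independent of the upper
     limit [t]; the strict inequality survives the upper limit thanks to it. *)
  pose c := 2 * delta * (V t1 / 2 * (b / 2)).
  have b2 : 0 < b / 2 by rewrite divr_gt0.
  have c0 : 0 < c by rewrite /c; do 2! apply: mulr_gt0 => //; exact: divr_gt0.
  apply: (@limf_esup_pinfty_lt0 _ _ (t1 + b / 2) (- c)%:E); last by rewrite lte_fin oppr_lt0.
  move=> t tt1; have t0 : 0 <= t by lra.
  have mI : measurable (`[0, t]%classic : set (measurableTypeR R)) by exact: measurable_itv.
  apply: (@le_trans _ _ (\int[lebesgue_measure]_(r in `[0, t])
      (- (expR (- (2 * delta) * r) * om r)))%R%:E).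
    apply: le_integral_Rintegral => //.
    - by apply: measurable_funS mg => //; apply: subset_itvl.
    - have := locintZ (-1) (proj1 Qp); move=> /(_ 0 t).
      by apply: eq_integrable => // r _ /=; rewrite mulN1r.
    - by move=> r /=; rewrite in_itv/= => /andP[r0 _]; exact: gle.
  have NQ := primitiveZ (-1) Qp.
  rewrite lee_fin (_ : \int[_]_(r in _) _ = -1 * (V t + 2 * delta * U t)
      - -1 * (V 0 + 2 * delta * U 0)); last first.
    by rewrite (proj2 NQ 0 t t0); apply: eq_Rintegral => r _; rewrite mulN1r.
  have U1 : U 0 <= U t1 by exact: primitive_nondecreasing Up V0 t10.
  have U2 : U (t1 + b / 2) <= U t by apply: (primitive_nondecreasing Up V0); exact: ltW.
  have U3 : V t1 / 2 * (t1 + b / 2 - t1) <= U (t1 + b / 2) - U t1.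
    apply: (primitive_ge_bound Up) => [|r /andP[r1 r2]]; first lra.
    by apply: Vb; rewrite ger0_norm ?subr_ge0//; lra.
  have e1 : t1 + b / 2 - t1 = b / 2 by ring.
  rewrite e1 in U3.
  have : c <= 2 * delta * (U t - U 0).
    by rewrite /c ler_pM2l ?mulr_gt0//; lra.
  have := V0 t; lra.
- have x0 t : 0 <= t -> x t = 0.
    by move=> t0; apply/eqP/negPn/negP => xt; apply: xne; exists t.
  have zs t : 0 <= t -> g t <= 0 /\ (g t = 0 -> d t = 0).
    move=> t0; have [tT|tT] := ltP t (updating_time s eta 0).
      have zt : sqnorm (z t) = 0.
        by rewrite /z x0// u0 ?t0// !mulmx0 addr0; exact: dotv0l.
      have g2 : 0 < gamma ^+ 2 by rewrite exprn_gt0.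
      rewrite /g zt noise0// sub0r oppr_le0 mulr_ge0 ?sqnorm_ge0 ?ltW//; split=> // /eqP.
      by rewrite oppr_eq0 mulf_eq0 gt_eqF//= => /eqP.
    have [k tk] := updating_time_cover Hs He tT.
    have [r0 _ [e ue He']] := sampled_control h0 Hcl tk.
    rewrite /measurement (x0 _ r0) mulmx0 add0r in ue He'.
    rewrite /g (noiseT k)// /z x0// mulmx0 add0r ue.
    set r := hold_time _ _ _ _ _ in r0 ue He' *.
    have H := Phi_zero_state e (w t) (v r).
    (* In the second phase the trigger inequality is strict, so [g t < 0] and the equality case is
       void. *)
    case: He' => [e0|[_ He']]; last by split; lra.
    rewrite e0 addr0 qform0 in H *.
    have Oe : 0 <= eps * qform Omega (mD2 S *m v r) by rewrite mulr_ge0//; exact: Omega_psd.2.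
    split=> [|gz]; first lra.
    by apply: (@zero_state_strict (w t) (v r) g0 eps0); rewrite /= gz.
  apply: upper_improper_integral_lt0 => //; first by move=> t /zs[].
  move=> gae; apply: dne0; apply: (negligibleS _ gae) => t /= dt gt0.
  by apply: dt => t0; have [_] := zs t t0; apply; exact: gt0.
Qed.

End Dissipation.

Close Scope classical_set_scope.
Unset Implicit Arguments.

Theorem theorem2 (R : realType) (n m nz l nw nv : nat)
    (S : ncs R n m nz l nw nv)
    (gamma h etaM eps delta : R)
    (gamma_gt0 : 0 < gamma) (h_gt0 : 0 < h) (etaM_ge0 : 0 <= etaM)
    (eps_ge0 : 0 <= eps) (delta_gt0 : 0 < delta)
    (P S0 S1 R0 R1 G0 G1 : 'M[R]_n) (Omega : 'M[R]_l)
    (P_posdef : posdef P)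
    (S0_psd : possemidef S0) (S1_psd : possemidef S1)
    (R0_psd : possemidef R0) (R1_psd : possemidef R1)
    (Omega_psd : possemidef Omega)
    (Psi_le0 : negsemidef
       (lmiPsi S gamma h etaM delta P S0 S1 R0 R1 G1))
    (Phi_le0 : negsemidef
       (lmiPhi S gamma h etaM eps delta P S0 S1 R0 R1 G0 Omega))
    (G0_ge0 : possemidef (symblock R0 G0 R0))
    (G1_ge0 : possemidef (symblock R1 G1 R1)) :
  int_exp_stable S h etaM eps Omega delta /\
  L2_gain_lt S h etaM eps Omega gamma.
Proof.
split.
  apply: (exponential_stability P_posdef S0_psd S1_psd R0_psd R1_psd Omega_psd
    Psi_le0 Phi_le0 G0_ge0 G1_ge0) => //; exact: ltW.
exact: (L2_gain P_posdef S0_psd S1_psd R0_psd R1_psd Omega_psd Psi_le0 Phi_le0 G0_ge0 G1_ge0).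
Qed.
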